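(* Let $L_+$ be an even Lie color algebra over a field $K$ with a proper grading by the abelian group $G$ and with bicharacter $\varepsilon:G\times G\to K^*$. If $\sigma$ is an $X$-inner automorphism of $U(L_+)$, then there exists some $h\in G$ such that (1) $x^\sigma=\varepsilon(h,g)x$ for all $x\in L_g$ with $g\neq 1$; (2) for every $x\in L_1$ there is $\alpha_x\in K$ with $x^\sigma=x+\alpha_x$.
   Context: Let $K$ be a field and $G$ an abelian group (written multiplicatively, identity $1$). An alternating bicharacter is a map $\varepsilon:G\times G\to K^*$ with $\varepsilon(g,hk)=\varepsilon(g,h)\varepsilon(g,k)$ and $\varepsilon(g,h)=\varepsilon(h,g)^{-1}$ for all $g,h,k\in G$. A Lie color algebra over $K$ is a $G$-graded $K$-vector space $L=\bigoplus_{g\in G}L_g$ with a $K$-bilinear bracket satisfying $[L_g,L_h]\subseteq L_{gh}$, $[x,y]=-\varepsilon(g,h)[y,x]$ and $[[x,y],z]=[x,[y,z]]-\varepsilon(g,h)[y,[x,z]]$ for all $x\in L_g$, $y\in L_h$, $z\in L$. It is even (written $L_+$) if $L_g=0$ whenever $\varepsilon(g,g)\ne 1$; in characteristic $2$ one additionally requires $[x,x]=0$ for homogeneous $x$. The elements of $\bigcup_g L_g$ are called homogeneous. The enveloping algebra $U(L_+)$ is the associative unital $K$-algebra generated by $L_+$ subject to the relations $xy-\varepsilon(g,h)yx=[x,y]$ for all $x\in L_g$, $y\in L_h$. By the Poincaré–Birkhoff–Witt theorem, if $\mathcal B$ is a totally ordered homogeneous basis of $L_+$, the ordered monomials in $\mathcal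 B$ form a $K$-basis of $U(L_+)$; $U(L_+)$ is a domain and is $G$-graded. The grading of $L_+$ by $G$ is proper if $\{g\in G\mid \varepsilon(g,k)=1\text{ for all }k\in G\}=\{1\}$ and $G$ is generated by the support $\{g\in G\mid L_g\neq0\}$ of $L_+$. For a prime ring $R$, $Q(R)$ denotes its symmetric Martindale quotient ring (the set of elements $q$ of the left Martindale quotient ring of $R$ for which there is a nonzero two-sided ideal $J$ of $R$ with $Jq\subseteq R$ and $qJ\subseteq R$), and $N(R)$ denotes the set of those $w\in Q(R)$ with $wR=Rw$. An automorphism $\sigma$ of $R$ is called $X$-inner if there is a nonzero $w\in N(R)$ such that $r^\sigma w=wr$ for all $r\in R$. Here $r^\sigma$ denotes the image of $r$ under $\sigma$. *)

(* Defs.v *)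
From HB Require Import structures.
From mathcomp Require Import all_boot all_order all_algebra.
From mathcomp Require Import boolp classical_sets.

Set Implicit Arguments.
Unset Strict Implicit.
Unset Printing Implicit Defensive.

Import GRing.Theory.
Local Open Scope ring_scope.
Local Open Scope classical_set_scope.
Local Open Scope quotient_scope.

(* [bichar_neq0] expresses that the values lie in K^*; it is not implied by
   [bicharV], because 0^-1 = 0 here. *)
Record altBicharacter (K : fieldType) (G : groupType) := AltBicharacter {
  bichar :> G -> G -> K;
  bichar_neq0 : forall g h, bichar g h != 0;
  bicharMr : forall g h k, bichar g (h * k)%g = bichar g h * bichar g k;
  bicharV : forall g h, bichar g h = (bichar h g)^-1
}.

(* [homog L g] is the component L_g; [homog_span] and [homog_free] say that L is
   the internal direct sum of its components. *)
Record lieColorAlgebra (K : fieldType) (G : groupType)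
    (eps : altBicharacter K G) := LieColorAlgebra {
  lca_space :> lmodType K;
  homog : G -> set lca_space;
  bracket : lca_space -> lca_space -> lca_space;
  homog0 : forall g, homog g 0;
  homogP : forall g a x y, homog g x -> homog g y -> homog g (a *: x + y);
  homog_span : forall x, exists (s : seq G) (c : G -> lca_space),
    (forall g, homog g (c g)) /\ x = \sum_(g <- s) c g;
  homog_free : forall (s : seq G) (c : G -> lca_space), uniq s ->
    (forall g, homog g (c g)) -> \sum_(g <- s) c g = 0 ->
    forall g, g \in s -> c g = 0;
  bracketPl : forall a x y z,
    bracket (a *: x + y) z = a *: bracket x z + bracket y z;
  bracketPr : forall a x y z,
    bracket z (a *: x + y) = a *: bracket z x + bracket z y;
  bracket_homog : forall g h x y, homog g x -> homog h y ->
    homog (g * h)%g (bracket x y);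
  bracket_skew : forall g h x y, homog g x -> homog h y ->
    bracket x y = - (eps g h *: bracket y x);
  bracket_jacobi : forall g h x y z, homog g x -> homog h y ->
    bracket (bracket x y) z =
      bracket x (bracket y z) - eps g h *: bracket y (bracket x z)
}.

Arguments homog {K G eps} L g x : rename.

Section LieColor.
Variables (K : fieldType) (G : groupType) (eps : altBicharacter K G).
Variable L : lieColorAlgebra eps.

Definition even_lca : Prop :=
  (forall g x, eps g g != 1 -> homog L g x -> x = 0) /\
  (2%N \in [pchar K] -> forall g x, homog L g x -> bracket x x = 0).

Definition lca_support : set G := [set g | exists2 x, homog L g x & x != 0].

Definition generates (S : set G) : Prop :=
  forall H : set G, H 1%g -> (forall g h, H g -> H h -> H (g / h)%g) ->
  S `<=` H -> H = setT.

Definition proper_grading : Prop :=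
  [set g | forall k, eps g k = 1] = [set 1%g] /\ generates lca_support.

(* The enveloping algebra: formal expressions in the elements of L and of K,
   modulo the smallest congruence containing the axioms of unital associative
   K-algebras (scaling by a is multiplication by the central element UCst a),
   the linearity of L -> U(L), and the defining relations. *)
Inductive uterm : Type :=
  | UGen of L
  | UCst of K
  | UAdd of uterm & uterm
  | UMul of uterm & uterm.

Inductive ucong : uterm -> uterm -> Prop :=
  | UCrefl u : ucong u u
  | UCsym u v : ucong u v -> ucong v u
  | UCtrans u v w : ucong u v -> ucong v w -> ucong u w
  | UCadd u u' v v' : ucong u u' -> ucong v v' -> ucong (UAdd u v) (UAdd u' v')
  | UCmul u u' v v' : ucong u u' -> ucong v v' -> ucong (UMul u v) (UMul u' v')
  | UCaddA u v w : ucong (UAdd u (UAdd v w)) (UAdd (UAdd u v) w)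
  | UCaddC u v : ucong (UAdd u v) (UAdd v u)
  | UCadd0 u : ucong (UAdd (UCst 0) u) u
  | UCaddN u : ucong (UAdd (UMul (UCst (-1)) u) u) (UCst 0)
  | UCmulA u v w : ucong (UMul u (UMul v w)) (UMul (UMul u v) w)
  | UCmul1 u : ucong (UMul (UCst 1) u) u
  | UCmulDl u v w : ucong (UMul (UAdd u v) w) (UAdd (UMul u w) (UMul v w))
  | UCmulDr u v w : ucong (UMul u (UAdd v w)) (UAdd (UMul u v) (UMul u w))
  | UCcstD a b : ucong (UCst (a + b)) (UAdd (UCst a) (UCst b))
  | UCcstM a b : ucong (UCst (a * b)) (UMul (UCst a) (UCst b))
  | UCcstC a u : ucong (UMul (UCst a) u) (UMul u (UCst a))
  | UCgen a x y :
      ucong (UGen (a *: x + y)) (UAdd (UMul (UCst a) (UGen x)) (UGen y))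
  | UCrel g h x y : homog L g x -> homog L h y ->
      ucong (UMul (UGen x) (UGen y))
            (UAdd (UMul (UCst (eps g h)) (UMul (UGen y) (UGen x)))
                  (UGen (bracket x y))).

HB.instance Definition _ := gen_eqMixin uterm.
HB.instance Definition _ := gen_choiceMixin uterm.

Definition ucongb (u v : uterm) : bool := `[< ucong u v >].

Lemma ucongb_refl : reflexive ucongb.
Proof. by move=> u; apply/asboolP; apply: UCrefl. Qed.

Lemma ucongb_sym : symmetric ucongb.
Proof. by move=> u v; apply/asboolP/asboolP; apply: UCsym. Qed.

Lemma ucongb_trans : transitive ucongb.
Proof. by move=> v u w /asboolP uv /asboolP vw; apply/asboolP/(UCtrans uv). Qed.

Canonical ucong_equiv := EquivRel ucongb ucongb_refl ucongb_sym ucongb_trans.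

Definition envalg : Type := {eq_quot ucong_equiv}.
HB.instance Definition _ := Choice.on envalg.
HB.instance Definition _ := EqQuotient.on envalg.

Definition uclass (u : uterm) : envalg := \pi_envalg u.

Lemma uclassP u v : uclass u = uclass v <-> ucong u v.
Proof.
rewrite /uclass; split; first by move=> /eqquotP /asboolP.
by move=> uv; apply/eqquotP/asboolP.
Qed.

Lemma urepr (x : envalg) : exists u, x = uclass u.
Proof. by exists (repr x); rewrite /uclass reprK. Qed.

Definition uadd (x y : envalg) := uclass (UAdd (repr x) (repr y)).
Definition umul (x y : envalg) := uclass (UMul (repr x) (repr y)).
Definition ucst (a : K) := uclass (UCst a).
Definition uscale (a : K) (x : envalg) := umul (ucst a) x.
Definition uopp (x : envalg) := umul (ucst (-1)) x.

Let repr_cong u : ucong (repr (uclass u)) u.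
Proof. by apply/uclassP; rewrite /uclass reprK. Qed.

Lemma uaddE u v : uadd (uclass u) (uclass v) = uclass (UAdd u v).
Proof. by apply/uclassP/UCadd; apply: repr_cong. Qed.

Lemma umulE u v : umul (uclass u) (uclass v) = uclass (UMul u v).
Proof. by apply/uclassP/UCmul; apply: repr_cong. Qed.

Let uE := (uaddE, umulE).
Ltac lift := repeat (let x := fresh in let u := fresh in
  move=> x; have [u ->] := urepr x); rewrite /uopp /uscale /ucst ?uE; apply/uclassP.

Fact uaddA : associative uadd. Proof. lift; exact: UCaddA. Qed.
Fact uaddC : commutative uadd. Proof. lift; exact: UCaddC. Qed.
Fact uadd0 : left_id (ucst 0) uadd. Proof. lift; exact: UCadd0. Qed.
Fact uaddN : left_inverse (ucst 0) uopp uadd. Proof. lift; exact: UCaddN. Qed.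
Fact umulA : associative umul. Proof. lift; exact: UCmulA. Qed.
Fact umul1l : left_id (ucst 1) umul. Proof. lift; exact: UCmul1. Qed.
Fact umul1r : right_id (ucst 1) umul.
Proof. lift; apply: UCtrans (UCmul1 _); exact/UCsym/UCcstC. Qed.
Fact umulDl : left_distributive umul uadd. Proof. lift; exact: UCmulDl. Qed.
Fact umulDr : right_distributive umul uadd. Proof. lift; exact: UCmulDr. Qed.

Fixpoint uaug (u : uterm) : K :=
  match u with
  | UGen _ => 0
  | UCst a => a
  | UAdd u v => uaug u + uaug v
  | UMul u v => uaug u * uaug v
  end.

Lemma uaug_cong u v : ucong u v -> uaug u = uaug v.
Proof.
elim=> //= {u v}; try by intros; congruence.
- by move=> u v w; rewrite addrA.
- by move=> u v; rewrite addrC.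
- by move=> u; rewrite add0r.
- by move=> u; rewrite mulN1r addNr.
- by move=> u v w; rewrite mulrA.
- by move=> u; rewrite mul1r.
- by move=> u v w; rewrite mulrDl.
- by move=> u v w; rewrite mulrDr.
- by move=> a u; rewrite mulrC.
- by move=> a _ _; rewrite mulr0 addr0.
- by move=> g h _ _ _ _; rewrite !mulr0 addr0.
Qed.

Fact ucst1_neq0 : ucst 1 != ucst 0.
Proof.
by apply/eqP => /uclassP /uaug_cong /= /eqP; rewrite oner_eq0.
Qed.

HB.instance Definition _ :=
  GRing.isZmodule.Build envalg uaddA uaddC uadd0 uaddN.
HB.instance Definition _ := GRing.Zmodule_isNzRing.Build envalg
  umulA umul1l umul1r umulDl umulDr ucst1_neq0.

Fact uscaleA a b x : uscale a (uscale b x) = uscale (a * b) x.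
Proof.
move: x; lift; apply: UCtrans (UCmulA _ _ _) _.
by apply: UCmul (UCrefl _); apply/UCsym/UCcstM.
Qed.
Fact uscale1 : left_id 1 uscale. Proof. exact: umul1l. Qed.
Fact uscaleDr : right_distributive uscale +%R.
Proof. by move=> a x y; apply: umulDr. Qed.
Fact uscaleDl x : {morph uscale^~ x : a b / a + b}.
Proof.
move=> a b; have -> : uscale (a + b) x = umul (uadd (ucst a) (ucst b)) x.
  by rewrite /uscale uaddE; congr umul; apply/uclassP/UCcstD.
exact: umulDl.
Qed.
HB.instance Definition _ := GRing.Zmodule_isLmodule.Build K envalg
  uscaleA uscale1 uscaleDr uscaleDl.

Fact uscaleAl a (x y : envalg) : a *: (x * y) = (a *: x) * y.
Proof. exact: umulA. Qed.
HB.instance Definition _ := GRing.Lmodule_isLalgebra.Build K envalg uscaleAl.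

Fact uscaleAr a (x y : envalg) : a *: (x * y) = x * (a *: y).
Proof.
have aC z : umul (ucst a) z = umul z (ucst a).
  by move: z; lift; apply: UCcstC.
by rewrite scalerAl [a *: x]aC -mulrA -[RHS]/(x * umul _ y).
Qed.
HB.instance Definition _ := GRing.Lalgebra_isAlgebra.Build K envalg uscaleAr.

Definition ugen (x : L) : envalg := uclass (UGen x).

Fact ugen_linear : linear ugen.
Proof.
move=> a x y; rewrite -[RHS]/(uadd (umul (ucst a) (ugen x)) (ugen y)).
rewrite /ucst /ugen !uE.
by apply/uclassP/UCgen.
Qed.
HB.instance Definition _ := GRing.isLinear.Build K L envalg *:%R ugen ugen_linear.

Lemma ugen_rel g h x y : homog L g x -> homog L h y ->
  ugen x * ugen y - eps g h *: (ugen y * ugen x) = ugen (bracket x y).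
Proof.
move=> gx hy; apply/eqP; rewrite subr_eq addrC; apply/eqP.
rewrite -[RHS]/(uadd (umul (ucst _) (umul _ _)) _).
by rewrite -[LHS]/(umul _ _) /ucst /ugen !uE; apply/uclassP/UCrel.
Qed.

Lemma envalg_universal (A : algType K) (f : {linear L -> A}) :
  (forall g h x y, homog L g x -> homog L h y ->
     f x * f y - eps g h *: (f y * f x) = f (bracket x y)) ->
  exists! F : envalg -> A,
    [/\ linear F, monoid_morphism F & forall x, F (ugen x) = f x].
Proof.
move=> frel.
pose ev := fix ev (u : uterm) : A :=
  match u with
  | UGen x => f x
  | UCst a => a%:A
  | UAdd u v => ev u + ev v
  | UMul u v => ev u * ev v
  end.
have evP u v : ucong u v -> ev u = ev v.
  elim=> //= {u v}; try by intros; congruence.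
  - by move=> u v w; rewrite addrA.
  - by move=> u v; rewrite addrC.
  - by move=> u; rewrite scale0r add0r.
  - by move=> u; rewrite scaleN1r mulN1r addNr scale0r.
  - by move=> u v w; rewrite mulrA.
  - by move=> u; rewrite scale1r mul1r.
  - by move=> u v w; rewrite mulrDl.
  - by move=> u v w; rewrite mulrDr.
  - by move=> a b; rewrite scalerDl.
  - by move=> a b; rewrite mulr_algl scalerA.
  - by move=> a u; rewrite mulr_algl mulr_algr.
  - by move=> a x y; rewrite linearP mulr_algl.
  - by move=> g h x y gx hy; rewrite -(frel _ _ _ _ gx hy) mulr_algl addrC subrK.
pose F (x : envalg) := ev (repr x).
have FE u : F (uclass u) = ev u by apply/evP/repr_cong.
have FM x y : F (x * y) = F x * F y.
  have [u ->] := urepr x; have [v ->] := urepr y.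
  by rewrite -[_ * _]/(umul _ _) umulE !FE.
have FD x y : F (x + y) = F x + F y.
  have [u ->] := urepr x; have [v ->] := urepr y.
  by rewrite -[_ + _]/(uadd _ _) uaddE !FE.
have FZ a x : F (a *: x) = a *: F x.
  by rewrite -[a *: x]/(ucst a * x) FM FE /= mulr_algl.
exists F; split.
  split; first by move=> a x y; rewrite FD FZ.
    by split=> //; rewrite -[1]/(ucst 1) FE /= scale1r.
  by move=> x; rewrite FE.
move=> F' [F'P [F'1 F'M] F'g]; apply/funext => x.
have F'D y z : F' (y + z) = F' y + F' z.
  by have := F'P 1 y z; rewrite !scale1r.
have F'0 : F' 0 = 0.
  by apply: (addrI (F' 0)); rewrite -F'D !addr0.
have F'Z a y : F' (a *: y) = a *: F' y.
  by have := F'P a y 0; rewrite F'0 !addr0.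
have [u ->] := urepr x; rewrite FE; elim: u => [y|a|u IHu v IHv|u IHu v IHv] /=.
- by rewrite F'g.
- have -> : uclass (UCst a) = a *: 1.
    by rewrite -[LHS]mulr1.
  by rewrite F'Z F'1.
- by rewrite -uaddE F'D IHu IHv.
- by rewrite -umulE F'M IHu IHv.
Qed.

End LieColor.

(* The left Martindale quotient ring Q_l(R) of a prime ring R is the set of
   left R-module maps f : I -> R on nonzero two-sided ideals I, two of them being
   identified when they agree on a nonzero ideal; f stands for the element q
   such that x q = f x for x in I.  Membership in Q(R), normality and X-innerness
   only involve products of elements of Q_l(R) by elements of R, so only the
   R-bimodule structure is defined. *)
Section Martindale.
Variable R : nzRingType.

Record nonzero_ideal (I : set R) : Prop := NonzeroIdeal {
  idealB : forall x y, I x -> I y -> I (x - y);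
  idealMl : forall a x, I x -> I (a * x);
  idealMr : forall a x, I x -> I (x * a);
  ideal_neq0 : exists2 x, I x & x != 0
}.

(* The values of [mfun] outside [mdom] are irrelevant. *)
Record martindale := Martindale {
  mdom : set R;
  mfun : R -> R;
  mdomP : nonzero_ideal mdom;
  mfunD : forall x y, mdom x -> mdom y -> mfun (x + y) = mfun x + mfun y;
  mfunM : forall a x, mdom x -> mfun (a * x) = a * mfun x
}.

Definition meq (p q : martindale) : Prop :=
  exists J : set R, [/\ nonzero_ideal J, J `<=` mdom p, J `<=` mdom q &
    forall x, J x -> mfun p x = mfun q x].

Fact setT_ideal : nonzero_ideal setT.
Proof. by split=> //; exists 1; rewrite ?oner_neq0. Qed.

Definition mconst (r : R) : martindale :=
  @Martindale setT (fun x => x * r) setT_ideal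
    (fun x y _ _ => mulrDl x y r) (fun a x _ => esym (mulrA a x r)).

Fact mlmulD (r : R) (q : martindale) x y : mdom q x -> mdom q y ->
  mfun q ((x + y) * r) = mfun q (x * r) + mfun q (y * r).
Proof. by move=> qx qy; rewrite mulrDl mfunD //; apply: idealMr (mdomP q) _ _ _. Qed.

Fact mlmulM (r : R) (q : martindale) a x : mdom q x ->
  mfun q (a * x * r) = a * mfun q (x * r).
Proof. by move=> qx; rewrite -mulrA mfunM //; apply: idealMr (mdomP q) _ _ _. Qed.

(* r q : x |-> (x r) q *)
Definition mlmul (r : R) (q : martindale) : martindale :=
  @Martindale (mdom q) (fun x => mfun q (x * r)) (mdomP q)
    (@mlmulD r q) (@mlmulM r q).

Fact mrmulD (q : martindale) (r : R) x y : mdom q x -> mdom q y ->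
  mfun q (x + y) * r = mfun q x * r + mfun q y * r.
Proof. by move=> qx qy; rewrite mfunD // mulrDl. Qed.

Fact mrmulM (q : martindale) (r : R) a x : mdom q x ->
  mfun q (a * x) * r = a * (mfun q x * r).
Proof. by move=> qx; rewrite mfunM // mulrA. Qed.

(* q r : x |-> (x q) r *)
Definition mrmul (q : martindale) (r : R) : martindale :=
  @Martindale (mdom q) (fun x => mfun q x * r) (mdomP q)
    (@mrmulD q r) (@mrmulM q r).

Definition symmetric_martindale (q : martindale) : Prop :=
  exists2 J : set R, nonzero_ideal J & forall x, J x ->
    (exists r, meq (mlmul x q) (mconst r)) /\
    (exists r, meq (mrmul q x) (mconst r)).

(* wR = Rw *)
Definition normalizing (w : martindale) : Prop :=
  (forall r, exists s, meq (mrmul w r) (mlmul s w)) /\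
  (forall r, exists s, meq (mlmul r w) (mrmul w s)).

Definition X_inner (sigma : R -> R) : Prop :=
  exists w : martindale,
    [/\ symmetric_martindale w, normalizing w, ~ meq w (mconst 0) &
        forall r, meq (mlmul (sigma r) w) (mrmul w r)].

End Martindale.

(* Main.v *)
Require Import Defs.
From HB Require Import structures.
From mathcomp Require Import all_boot all_order all_algebra.
From mathcomp Require Import boolp classical_sets wochoice.
From mathcomp Require Import zify ring.
Import GRing.Theory.
Local Open Scope ring_scope.

(** Write U for the enveloping algebra.  Once U is known to be a domain, the
    element w that makes sigma X-inner produces nonzero x, y, x' in U with

      x * sigma r * y = y * r * x'   for every r,

    namely any x with y := x w nonzero, together with the preimage x' of x under
    sigma ([X_inner_gpi]).  The rest of the proof exploits this identity.

    By the Poincare-Birkhoff-Witt theorem the ordered monomials in a homogeneous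
    basis of L form a basis of U, and any two generators commute up to a nonzero
    scalar modulo shorter words.  So, for a total order on words which compares
    first the lengths and then the multiplicities of the letters, leading terms
    multiply ([lead_mul]).  Comparing leading terms in the identity for r = 1 and
    for r = x_i, a basis element of degree d_i, shows that sigma x_i has leading
    letter x_i, with a coefficient that measures how x_i commutes past the leading
    words of x and y: it is eps h d_i, where h is the quotient of the degrees of
    those two words ([gpi_leading_gen]).  Hence sigma x_i = eps h d_i * x_i + lower
    terms, and the lower terms are a scalar plus letters smaller than x_i.  The
    argument works for every total order on the basis.  Applied to the reversed
    order, it bounds the same lower terms by letters larger than x_i, so only the
    scalar survives ([gpi_affine]).

    This scalar vanishes when the degree g of x_i is not 1.  As the grading is
    proper, there is a basis element x_j with eps g d_j <> 1, so x_j <> x_i, and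
    applying sigma to the commutation relation of x_i and x_j leaves the term
    scalar * (1 - eps g d_j) * x_j with nothing to cancel it.

    The basis theorem is proved by duality.  A function on words is the restriction
    to monomials of a linear form on U exactly when it respects the straightening
    relations at every pair of adjacent letters ([compat]), and every function on
    sorted words extends to such a function ([compat_extension]): straighten
    descents in any order, the color Jacobi identity making the outcome independent
    of the order ([compat_confluence]). *)
Set Implicit Arguments.
Unset Strict Implicit.
Unset Printing Implicit Defensive.

(** * Linear spans *)

Section Span.
Variables (K : fieldType) (V : lmodType K).
Implicit Types (x y z : V).

Section Family.
Variables (T : Type) (P : T -> Prop) (F : T -> V).

Inductive lspan : V -> Prop :=
  | lspan0 : lspan 0
  | lspanS a t z of P t & lspan z : lspan (a *: F t + z).

Lemma lspan_gen t : P t -> lspan (F t).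
Proof. by move=> Pt; rewrite -[F t]addr0 -[F t]scale1r; exact/lspanS/lspan0. Qed.

Lemma lspanD x y : lspan x -> lspan y -> lspan (x + y).
Proof.
move=> sx sy; elim: sx => [|a t z Pt _ IH]; first by rewrite add0r.
by rewrite -addrA; apply: lspanS.
Qed.

Lemma lspanZ a x : lspan x -> lspan (a *: x).
Proof.
elim=> [|b t z Pt _ IH]; first by rewrite scaler0; exact: lspan0.
by rewrite scalerDr scalerA; apply: lspanS.
Qed.

Lemma lspanN x : lspan x -> lspan (- x).
Proof. by rewrite -scaleN1r; exact: lspanZ. Qed.

Lemma lspanB x y : lspan x -> lspan y -> lspan (x - y).
Proof. by move=> sx /lspanN; exact: lspanD. Qed.

Lemma lspan_sum (I : Type) (r : seq I) (Q : pred I) (E : I -> V) :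
  (forall i, Q i -> lspan (E i)) -> lspan (\sum_(i <- r | Q i) E i).
Proof. by move=> h; elim/big_ind: _ => //; [exact: lspan0 | exact: lspanD]. Qed.

End Family.

Lemma lspan_le (T T' : Type) (P : T -> Prop) (P' : T' -> Prop) F F' x :
  (forall t, P t -> lspan P' F' (F t)) -> lspan P F x -> lspan P' F' x.
Proof.
move=> h; elim=> [|a t z Pt _ IH]; first exact: lspan0.
by apply: lspanD IH; apply/lspanZ/h.
Qed.

Lemma lspan_sub (T : Type) (P P' : T -> Prop) F x :
  (forall t, P t -> P' t) -> lspan P F x -> lspan P' F x.
Proof. by move=> h; apply: lspan_le => t /h; exact: lspan_gen. Qed.

(** Collecting repeated indices and dropping zero coefficients: the form in
    which the largest index of a combination can be singled out. *)
Lemma lspan_uniq (T : eqType) (P : T -> Prop) (F : T -> V) x : lspan P F x ->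
  exists (s : seq T) (c : T -> K), [/\ uniq s, forall t, t \in s -> P t,
    forall t, t \in s -> c t != 0 & x = \sum_(t <- s) c t *: F t].
Proof.
suff: lspan P F x -> exists (s : seq T) (c : T -> K), [/\ uniq s,
    forall t, t \in s -> P t & x = \sum_(t <- s) c t *: F t].
  move=> h /h [s [c [us sP ->]]]; exists [seq t <- s | c t != 0], c.
  split; first exact: filter_uniq.
  - by move=> t; rewrite mem_filter => /andP[_ /sP].
  - by move=> t; rewrite mem_filter => /andP[].
  rewrite big_filter [RHS]big_mkcond /=; apply: eq_bigr => t _.
  by case: eqVneq => //= ->; rewrite scale0r.
elim=> {x} [|a t z Pt _ [s [c [us sP ->]]]].
  by exists [::], (fun=> 0); split=> //; rewrite big_nil.
pose c' u := if u == t then a + (if t \in s then c t else 0) else c u.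
have [ts|ts] := boolP (t \in s).
  exists s, c'; split=> //; rewrite [in LHS](bigD1_seq t) // [in RHS](bigD1_seq t) //=
    addrA /c' eqxx ts scalerDl.
  by congr (_ + _); apply: eq_bigr => u /negPf ->.
exists (t :: s), c'; split=> /=; first by rewrite ts.
  by move=> u; rewrite inE => /predU1P[-> //|/sP].
rewrite big_cons /c' eqxx (negPf ts) addr0; congr (_ + _).
apply: eq_big_seq => u us'; case: eqVneq us' => // ->.
by rewrite (negPf ts).
Qed.

End Span.

(** * Homogeneous bases *)

Section WellOrder.
Variables (T : eqType) (R : rel T).
Hypothesis Rwo : well_order R.

Let Rwo' : wo_chain R predT. Proof. by move=> A _; exact: Rwo. Qed.

Lemma well_order_total : total R.
Proof. by move=> x y; apply: (wo_chainW Rwo'). Qed.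

Lemma well_order_anti : antisymmetric R.
Proof. by move=> x y; apply: (wo_chain_antisymmetric Rwo'). Qed.

Lemma well_order_trans : transitive R.
Proof.
move=> y x z Rxy Ryz.
have [|m [[mA mle] _]] := Rwo (A := mem [:: x; y; z]).
  by exists x; apply: mem_head.
have /mle Rmx : x \in [:: x; y; z] by rewrite mem_head.
have /mle Rmy : y \in [:: x; y; z] by rewrite !inE eqxx orbT.
have /mle Rmz : z \in [:: x; y; z] by rewrite !inE eqxx !orbT.
move: mA; rewrite !inE => /or3P[] /eqP mE; subst m => //.
  by have -> : x = y by apply: well_order_anti; rewrite Rxy.
by have <- : y = z by apply: well_order_anti; rewrite Ryz.
Qed.

Lemma well_order_ind (P : T -> Prop) :
  (forall x, (forall y, R y x -> y != x -> P y) -> P x) -> forall x, P x.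
Proof.
move=> h x; apply: contrapT => nPx.
have [|m [[/asboolP mA mle] _]] := Rwo (A := fun y => `[< ~ P y >]).
  by exists x; apply/asboolP.
apply: (mA); apply: h => y Rym nym; apply: contrapT => nPy.
have /mle Rmy : y \in (fun y => `[< ~ P y >]) by apply/asboolP.
by move/eqP: nym; apply; apply: well_order_anti; rewrite Rym.
Qed.

End WellOrder.

Lemma ex_max (T : eqType) (R : rel T) (s : seq T) : total R -> transitive R ->
  s != [::] -> exists2 x, x \in s & forall y, y \in s -> R y x.
Proof.
move=> Rtot Rtr; elim: s => // x s IH _.
have Rxx y : R y y by have := Rtot y y; rewrite orbb.
have [->|/IH [m ms mmax]] := eqVneq s [::].
  by exists x; rewrite ?inE // => y; rewrite inE => /eqP ->.
case/orP: (Rtot x m) => Rxm.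
  exists m; first by rewrite inE ms orbT.
  by move=> y; rewrite inE => /predU1P[->//|]; exact: mmax.
exists x; first exact: mem_head.
move=> y; rewrite inE => /predU1P[-> //|/mmax Rym]; exact: Rtr Rym Rxm.
Qed.

Section HomogBasis.
Variables (K : fieldType) (G : groupType) (eps : altBicharacter K G).
Variable L : lieColorAlgebra eps.

(** A homogeneous Hamel basis with a total order on its index set.  Linear
    independence is recorded through the dual property [hb_coord]: every function
    on the index set is the restriction of a linear form. *)
Record homogBasis := HomogBasis {
  hbI : choiceType;
  hb : hbI -> L;
  hbdeg : hbI -> G;
  hb_le : rel hbI;
  hb_le_total : total hb_le;
  hb_le_anti : antisymmetric hb_le;
  hb_le_trans : transitive hb_le;
  hb_neq0 : forall i, hb i != 0;
  hb_homog : forall i, homog L (hbdeg i) (hb i);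
  hb_span : forall g x, homog L g x -> lspan (fun i => hbdeg i = g) hb x;
  hb_coord : forall f : hbI -> K, {l : {scalar L} | forall i, l (hb i) = f i}
}.

Lemma homogZ g a x : homog L g x -> homog L g (a *: x).
Proof. by move=> gx; rewrite -[_ *: _]addr0; apply: homogP => //; exact: homog0. Qed.

Lemma homogD g x y : homog L g x -> homog L g y -> homog L g (x + y).
Proof. by move=> gx; rewrite -[x]scale1r; apply: homogP. Qed.

Lemma homog_sum g (I : Type) (r : seq I) (Q : pred I) (E : I -> L) :
  (forall i, Q i -> homog L g (E i)) -> homog L g (\sum_(i <- r | Q i) E i).
Proof. by move=> h; elim/big_ind: _ => //; [exact: homog0 | exact: homogD]. Qed.

Section Extend.
Variables (I : eqType) (b : I -> L).
Hypothesis b_span : forall x : L, lspan (fun=> True) b x.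
Hypothesis b_free : forall (s : seq I) (c : I -> K), uniq s ->
  \sum_(i <- s) c i *: b i = 0 -> forall i, i \in s -> c i = 0.

Lemma free_extend (f : I -> K) : {l : {scalar L} | forall i, l (b i) = f i}.
Proof.
have big_sub (s t : seq I) (c : I -> K) (W : lmodType K) (F : I -> W) :
    uniq s -> uniq t -> {subset s <= t} ->
    \sum_(i <- s) c i *: F i = \sum_(i <- t) (if i \in s then c i else 0) *: F i.
  move=> us ut st; rewrite [RHS](bigID (mem s)) /= [X in _ + X]big1 ?addr0.
    rewrite -[RHS]big_filter (perm_big [seq i <- t | i \in s]) /=.
      by apply: eq_big_seq => i; rewrite mem_filter => /andP[-> _].
    apply: uniq_perm; rewrite ?filter_uniq // => i.
    by rewrite mem_filter; case: (boolP (i \in s)) => // /st ->.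
  by move=> i /negPf ->; rewrite scale0r.
(* The value assigned to a vector does not depend on its expansion. *)
have wd (s t : seq I) (c e : I -> K) : uniq s -> uniq t ->
    \sum_(i <- s) c i *: b i = \sum_(i <- t) e i *: b i ->
    \sum_(i <- s) c i *: (f i : K^o) = \sum_(i <- t) e i *: (f i : K^o).
  move=> us ut; pose r := undup (s ++ t).
  have ur : uniq r by exact: undup_uniq.
  have sr : {subset s <= r} by move=> i si; rewrite mem_undup mem_cat si.
  have tr : {subset t <= r} by move=> i si; rewrite mem_undup mem_cat si orbT.
  rewrite !(big_sub s r) // !(big_sub t r) // => /eqP.
  rewrite -subr_eq0 -sumrB => /eqP eq0.
  have {}eq0 : \sum_(i <- r) ((if i \in s then c i else 0) -
       (if i \in t then e i else 0)) *: b i = 0.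
    by rewrite -[RHS]eq0; apply: eq_bigr => i _; rewrite scalerBl.
  have /= h := b_free ur eq0.
  apply: eq_big_seq => i /h /eqP; rewrite subr_eq0 => /eqP -> //.
have /choice [F FP] x : exists k : K, exists (s : seq I) (c : I -> K), [/\ uniq s,
    x = \sum_(i <- s) c i *: b i & k = \sum_(i <- s) c i *: (f i : K^o)].
  have [s [c [us _ _ ->]]] := lspan_uniq (b_span x).
  by exists (\sum_(i <- s) c i *: (f i : K^o)), s, c.
have Flin : linear (F : L -> K^o).
  move=> a x y; have [s [c [us {2}-> ->]]] := FP x.
  have [t [e [ut {2}-> ->]]] := FP y.
  have [r [k [ur rE ->]]] := FP (a *: (\sum_(i <- s) c i *: b i) +
    \sum_(i <- t) e i *: b i).
  pose q := undup (s ++ t).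
  have uq : uniq q by exact: undup_uniq.
  have sq : {subset s <= q} by move=> i si; rewrite mem_undup mem_cat si.
  have tq : {subset t <= q} by move=> i si; rewrite mem_undup mem_cat si orbT.
  pose m i := a * (if i \in s then c i else 0) + (if i \in t then e i else 0).
  have mE (W : lmodType K) (H : I -> W) : a *: (\sum_(i <- s) c i *: H i) +
      \sum_(i <- t) e i *: H i = \sum_(i <- q) m i *: H i.
    rewrite !(big_sub s q) // !(big_sub t q) // scaler_sumr -big_split /=.
    by apply: eq_bigr => i _; rewrite scalerDl scalerA.
  rewrite mE; apply: wd => //; by rewrite -rE mE.
pose l : {scalar L} := HB.pack (F : L -> K) (GRing.isLinear.Build K L K _ (F : L -> K) Flin).
exists l => i; rewrite /l /=; have [s [c [us sE ->]]] := FP (b i).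
rewrite (wd s [:: i] c (fun=> 1)) //; first by rewrite big_seq1 scale1r.
by rewrite -sE big_seq1 scale1r.
Qed.
End Extend.

(** Well-order L and keep the homogeneous elements that are not in the span of
    the smaller homogeneous elements.  They span by well-founded induction, and a
    nontrivial relation would put its largest member in the span of smaller ones.
    The components of L being independent, the expansion of an element of degree g
    only involves basis elements of degree g. *)
Lemma homog_basis_exists : inhabited homogBasis.
Proof.
have [R Rwo] := well_ordering_principle L.
have Rtot := well_order_total Rwo; have Ranti := well_order_anti Rwo.
have Rtr := well_order_trans Rwo.
pose low x y := [/\ (exists g, homog L g y), R y x & y != x].
pose B (x : L) := (exists g, homog L g x) /\ ~ lspan (low x) id x.
pose I : choiceType := {x : L | `[< B x >]}.
have IB (i : I) : B (val i) by case: i => x /= /asboolP.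
have [d dP] := @choice I G (fun i g => homog L g (val i)) (fun i => (IB i).1).
pose b (i : I) : L := val i.
have b_span0 x : (exists g, homog L g x) -> lspan (fun=> True) b x.
  elim/(well_order_ind Rwo): x => x IH hx.
  have [Bx|/not_andP[//|/contrapT]] := pselect (B x).
    have Bx' : `[< B x >] by apply/asboolP.
    by apply: (@lspan_gen _ _ I _ b (exist _ x Bx')).
  by apply: lspan_le => y [hy Ryx nyx]; apply: IH.
have b_span x : lspan (fun=> True) b x.
  have [s [c [ch ->]]] := homog_span x.
  by apply: lspan_sum => g _; apply: b_span0; exists g.
have b_free (s : seq I) (c : I -> K) : uniq s ->
    \sum_(i <- s) c i *: b i = 0 -> forall i, i \in s -> c i = 0.
  move=> us sum0 i si; apply: contrapT => /eqP ci.
  pose s' := [seq j <- s | c j != 0].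
  have s'0 : s' != [::].
    by apply/eqP => s'E; have := in_nil i; rewrite -s'E mem_filter ci si.
  pose RI (j k : I) := R (b j) (b k).
  have [||m ms' mmax] := @ex_max I RI s' _ _ s'0.
  - by move=> j k; apply: Rtot.
  - by move=> j k l; apply: Rtr.
  have [cm sm] : c m != 0 /\ m \in s by move: ms'; rewrite mem_filter => /andP[].
  have [_ []] := IB m.
  move: sum0; rewrite (bigD1_seq m) //= => /eqP; rewrite addr_eq0 => /eqP sumE.
  suff: lspan (low (val m)) id (c m *: b m).
    by move/(lspanZ (c m)^-1); rewrite scalerA mulVf // scale1r.
  rewrite sumE; apply/lspanN.
  rewrite big_seq_cond; apply: lspan_sum => j /andP[sj njm].
  have [->|cj] := eqVneq (c j) 0; first by rewrite scale0r; exact: lspan0.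
  apply/lspanZ; apply: (@lspan_gen _ _ _ _ id (b j)); split.
  - by exists (d j).
  - by apply: (mmax j); rewrite mem_filter cj.
  - by apply: contra njm => /eqP/val_inj ->.
constructor; apply: (@HomogBasis I b d (fun i j => R (b i) (b j))) => //.
- by move=> i j /Ranti /val_inj.
- by move=> i j k; apply: Rtr.
- move=> i; apply/eqP => bi0; have [_ []] := IB i.
  by rewrite -/(b i) bi0; exact: lspan0.
- move=> g x gx; have [s [c [us _ _ xE]]] := lspan_uniq (b_span x).
  (* The component of degree h of the difference between the expansion and x. *)
  pose C h := \sum_(i <- s | d i == h) c i *: b i - (if h == g then x else 0).
  have Ch h : homog L h (C h).
    rewrite /C -scaleN1r; apply: homogD.
      by apply: homog_sum => i /eqP <-; apply/homogZ/dP.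
    by apply: homogZ; case: eqP => [->//|_]; exact: homog0.
  pose r := undup (g :: map d s).
  have gr : g \in r by rewrite mem_undup mem_head.
  have pick h (y : L) : h \in r -> \sum_(k <- r) (if h == k then y else 0) = y.
    move=> hr; rewrite (bigD1_seq h) ?undup_uniq //= eqxx big1 ?addr0 //.
    by move=> k /negPf; rewrite eq_sym => ->.
  have C0 : \sum_(h <- r) C h = 0.
    rewrite sumrB; under [X in _ - X]eq_bigr do rewrite eq_sym.
    rewrite (pick g) //; apply/eqP; rewrite subr_eq0 xE; apply/eqP.
    under eq_bigr do rewrite big_mkcond.
    rewrite exchange_big /=; apply: eq_big_seq => i si; apply: pick.
    by rewrite mem_undup inE map_f ?orbT.
  have /eqP := @homog_free _ _ _ L r C (undup_uniq _) Ch C0 g gr.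
  rewrite /C eqxx subr_eq0 => /eqP <-.
  by apply: lspan_sum => i /eqP dig; apply/lspanZ/lspan_gen.
- by move=> f; exact: free_extend.
Qed.

End HomogBasis.

(** * Words in the basis and straightening *)

Section PBW.
Variables (K : fieldType) (G : groupType) (eps : altBicharacter K G).
Variable L : lieColorAlgebra eps.
Hypothesis evenL : even_lca L.

Lemma bichar1r g : eps g 1%g = 1.
Proof.
apply: (mulfI (bichar_neq0 eps g 1%g)).
by rewrite mulr1 -bicharMr mulg1.
Qed.

Lemma bicharC g h : eps g h * eps h g = 1.
Proof. by rewrite (bicharV eps h g) mulfV ?bichar_neq0. Qed.

Lemma bicharMl g h k : eps (g * h)%g k = eps g k * eps h k.
Proof. by rewrite bicharV bicharMr invfM -!bicharV. Qed.

Lemma bichar1l g : eps 1%g g = 1.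
Proof. by rewrite bicharV bichar1r invr1. Qed.

Lemma bracket0l x : bracket (l := L) 0 x = 0.
Proof. by have := bracketPl (-1) 0 0 x; rewrite scaler0 add0r scaleN1r addNr. Qed.

Lemma bracket0r x : bracket (l := L) x 0 = 0.
Proof. by have := bracketPr (-1) 0 0 x; rewrite scaler0 add0r scaleN1r addNr. Qed.

Variable B : homogBasis L.
Local Notation I := (hbI B).
Local Notation b := (@hb _ _ _ _ B).
Local Notation d := (@hbdeg _ _ _ _ B).
Local Notation e i j := (eps (d i) (d j)).
Local Notation leB := (@hb_le _ _ _ _ B).
Local Notation word := (seq I).
Implicit Types (i j k l : I) (u v w : word) (f : I -> K) (phi : word -> K).

Lemma e_diag i : e i i = 1.
Proof.
apply: contrapT => /eqP eii; move: (hb_neq0 i).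
by rewrite (evenL.1 (d i) (b i) eii (hb_homog i)) eqxx.
Qed.

(** Skew-symmetry gives 2 [x, x] = 0; in characteristic 2, where this is void,
    the vanishing is part of [even_lca]. *)
Lemma bracket_diag i : bracket (b i) (b i) = 0.
Proof.
have [ch2|ch2] := boolP (2%N \in [pchar K]).
  exact: evenL.2 ch2 (d i) _ (hb_homog i).
have := bracket_skew (hb_homog i) (hb_homog i).
rewrite e_diag scale1r => /eqP; rewrite -addr_eq0 -mulr2n -scaler_nat scaler_eq0.
by case/orP => [h2|/eqP //]; move: ch2; rewrite inE /= h2.
Qed.

Lemma homog_ind g (P : L -> Prop) : P 0 ->
  (forall a x y, P x -> P y -> P (a *: x + y)) ->
  (forall i, d i = g -> P (b i)) -> forall x, homog L g x -> P x.
Proof. by move=> P0 PD Pb x /(hb_span B); elim => // a t z dt _; apply: PD; exact: Pb. Qed.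

Lemma basis_ind (P : L -> Prop) : P 0 ->
  (forall a x y, P x -> P y -> P (a *: x + y)) ->
  (forall i, P (b i)) -> forall x, P x.
Proof.
move=> P0 PD Pb x; have [s [c [ch ->]]] := homog_span x.
elim/big_ind: _ => // [y z Py Pz|g _]; first by rewrite -[y]scale1r; exact: PD.
exact: homog_ind (ch g).
Qed.

(** The linear form on L with prescribed values on the basis.  Applied to
    [fun k => phi (u ++ k :: v)], it extends phi to words in which one letter is
    replaced by a vector. *)
Definition lin f : {scalar L} := sval (hb_coord (h := B) f).

Lemma linE f i : lin f (b i) = f i.
Proof. exact: (svalP (hb_coord f)). Qed.

Lemma lin_comb a f f' x : lin (fun i => a * f i + f' i) x = a * lin f x + lin f' x.
Proof.
elim/basis_ind: x => [|c x y IHx IHy|i]; first by rewrite !linear0 mulr0 addr0.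
  by rewrite !linearP IHx IHy !mulrDr !mulrA [a * c]mulrC addrACA.
by rewrite !linE.
Qed.

Lemma eq_lin f f' x : f =1 f' -> lin f x = lin f' x.
Proof. by move=> /funext ->. Qed.

Lemma lin0 x : lin (fun=> 0) x = 0.
Proof.
elim/basis_ind: x => [|c x y IHx IHy|i]; first by rewrite linear0.
  by rewrite linearP IHx IHy mulr0 addr0.
by rewrite linE.
Qed.

Lemma linZl a f x : lin (fun i => a * f i) x = a * lin f x.
Proof. by rewrite -[RHS]addr0 -(lin0 x) -lin_comb; apply: eq_lin => i; rewrite addr0. Qed.

Lemma linDl f f' x : lin (fun i => f i + f' i) x = lin f x + lin f' x.
Proof. by rewrite -[lin f x]mul1r -lin_comb; apply: eq_lin => i; rewrite mul1r. Qed.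

(** Words with two letters replaced by vectors are unambiguous. *)
Lemma lin_exchange (F : I -> I -> K) x y :
  lin (fun i => lin (F i) y) x = lin (fun j => lin (F^~ j) x) y.
Proof.
elim/basis_ind: x => [|c x z IHx IHz|i].
- by rewrite linear0 -[LHS](lin0 y); apply: eq_lin => j; rewrite linear0.
- rewrite linearP IHx IHz -lin_comb; apply: eq_lin => j; by rewrite linearP.
- by rewrite linE; apply: eq_lin => j; rewrite linE.
Qed.

(** The value that the relation x_i x_j = eps x_j x_i + [x_i, x_j] forces on the
    word u i j v. *)
Definition straight phi u i j v :=
  e i j * phi (u ++ j :: i :: v) + lin (fun k => phi (u ++ k :: v)) (bracket (b i) (b j)).

Definition compat_at phi u i j v := phi (u ++ i :: j :: v) = straight phi u i j v.

Definition compat phi := forall u i j v, compat_at phi u i j v.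

Definition compat_upto n phi :=
  forall u i j v, (size (u ++ i :: j :: v) <= n)%N -> compat_at phi u i j v.

Lemma compat_sym phi u i j v : compat_at phi u i j v -> compat_at phi u j i v.
Proof.
rewrite /compat_at /straight => ->; rewrite mulrDr mulrA bicharC mul1r -addrA.
rewrite (bracket_skew (hb_homog j) (hb_homog i)) linearN linearZ /=.
by rewrite addrN addr0.
Qed.

Lemma compat_diag phi u i v : compat_at phi u i i v.
Proof. by rewrite /compat_at /straight e_diag mul1r bracket_diag linear0 addr0. Qed.

(** Compatibility at pairs of letters extends by linearity to a letter followed
    by a homogeneous vector; this is what allows moving brackets past letters. *)
Lemma compat_vecr n phi u i v g x : compat_upto n phi -> homog L g x ->
    (size (u ++ i :: i :: v) <= n)%N ->
  lin (fun k => phi (u ++ i :: k :: v)) x =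
  eps (d i) g * lin (fun k => phi (u ++ k :: i :: v)) x
    + lin (fun k => phi (u ++ k :: v)) (bracket (b i) x).
Proof.
move=> cphi gx szn; elim/homog_ind: gx => [|a y z IHy IHz|j <-].
- by rewrite bracket0r !linear0 mulr0 addr0.
- rewrite bracketPr !linearP IHy IHz !mulrDr !mulrA [_ * a]mulrC -!mulrA -!addrA.
  by congr (_ + _); rewrite addrCA.
- by rewrite !linE; apply: cphi; move: szn; rewrite !size_cat.
Qed.

Lemma compat_vecl n phi u j v g x : compat_upto n phi -> homog L g x ->
    (size (u ++ j :: j :: v) <= n)%N ->
  lin (fun k => phi (u ++ k :: j :: v)) x =
  eps g (d j) * lin (fun k => phi (u ++ j :: k :: v)) x
    + lin (fun k => phi (u ++ k :: v)) (bracket x (b j)).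
Proof.
move=> cphi gx szn; elim/homog_ind: gx => [|a y z IHy IHz|i <-].
- by rewrite bracket0l !linear0 mulr0 addr0.
- rewrite bracketPl !linearP IHy IHz !mulrDr !mulrA [_ * a]mulrC -!mulrA -!addrA.
  by congr (_ + _); rewrite addrCA.
- by rewrite !linE; apply: cphi; move: szn; rewrite !size_cat.
Qed.

Definition hb_lt i j := ~~ hb_le j i.

(** Number of inversions: the measure that decreases when a descent is
    swapped. *)
Fixpoint inv w : nat :=
  if w is i :: w' then (count (fun j => hb_lt j i) w' + inv w')%N else 0%N.

Lemma hb_lt_asym i j : hb_lt i j -> hb_lt j i = false.
Proof. by rewrite /hb_lt; case/orP: (hb_le_total i j) => ->. Qed.

Lemma inv_swap u i j v : hb_lt j i -> inv (u ++ i :: j :: v) = (inv (u ++ j :: i :: v)).+1.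
Proof.
move=> ji; elim: u => [|k u IH] /=; last first.
  by rewrite IH !count_cat /=; lia.
by rewrite ji (hb_lt_asym ji) /=; lia.
Qed.

Lemma cat_split (u u' v v' : word) : u ++ v = u' ++ v' -> (size u <= size u')%N ->
  exists w, u' = u ++ w /\ v = w ++ v'.
Proof.
elim: u u' => [|i u IH] u' /=; first by move=> -> _; exists u'.
case: u' => [//|j u'] /= [-> eqs] szu.
by have [w [-> ->]] := IH _ eqs szu; exists w.
Qed.

(** Confluence of straightening on words of length n + 1, by induction on the
    number of inversions: phi is compatible on shorter words, and on words of
    length n + 1 with fewer than m inversions. *)
Section Confluence.
Variables (n m : nat) (phi : word -> K).
Hypothesis low : compat_upto n phi.
Hypothesis IH : forall u i j v, hb_lt j i -> size (u ++ i :: j :: v) = n.+1 ->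
  (inv (u ++ i :: j :: v) < m)%N -> compat_at phi u i j v.

(** Two descents that share no letter can be straightened one after the other,
    in either order. *)
Lemma straight_disjoint u i j w k l v :
  hb_lt j i -> hb_lt l k -> size (u ++ i :: j :: w ++ k :: l :: v) = n.+1 ->
  (inv (u ++ i :: j :: w ++ k :: l :: v) <= m)%N ->
  straight phi u i j (w ++ k :: l :: v) = straight phi (u ++ i :: j :: w) k l v.
Proof.
move=> ji lk szw invm; rewrite /straight.
have assoc u' i' j' v' : (u' ++ i' :: j' :: w) ++ v' = u' ++ i' :: j' :: w ++ v'.
  by rewrite -catA.
have inv1 := inv_swap u (w ++ k :: l :: v) ji.
have inv2 := inv_swap (u ++ i :: j :: w) v lk; rewrite !assoc in inv2.
have -> : phi (u ++ j :: i :: w ++ k :: l :: v) = straight phi (u ++ j :: i :: w) k l v.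
  rewrite -assoc; apply: IH; rewrite ?assoc //; last by lia.
  by move: szw; rewrite !size_cat /=.
have -> : phi ((u ++ i :: j :: w) ++ l :: k :: v) = straight phi u i j (w ++ l :: k :: v).
  rewrite assoc; apply: IH => //; last by lia.
  by move: szw; rewrite !size_cat /= !size_cat /=.
have -> : lin (fun x => phi (u ++ x :: w ++ k :: l :: v)) (bracket (b i) (b j)) =
    lin (fun x => e k l * phi (u ++ x :: w ++ l :: k :: v) +
      lin (fun y => phi (u ++ x :: w ++ y :: v)) (bracket (b k) (b l))) (bracket (b i) (b j)).
  apply: eq_lin => x; have := @low (u ++ x :: w) k l v.
  rewrite /compat_at /straight -!catA /= => -> //; last first.
    by move: szw; rewrite !size_cat /= !size_cat /=; lia.
  by congr (_ + _); apply: eq_lin => y; rewrite -!catA.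
have -> : lin (fun y => phi ((u ++ i :: j :: w) ++ y :: v)) (bracket (b k) (b l)) =
    lin (fun y => e i j * phi (u ++ j :: i :: w ++ y :: v) +
      lin (fun x => phi (u ++ x :: w ++ y :: v)) (bracket (b i) (b j))) (bracket (b k) (b l)).
  apply: eq_lin => x; rewrite assoc; apply: low.
  by move: szw; rewrite !size_cat /= !size_cat /=; lia.
rewrite !linDl !linZl lin_exchange /straight !assoc.
rewrite (@eq_lin (fun y => phi ((u ++ j :: i :: w) ++ y :: v))
  (fun y => phi (u ++ j :: i :: w ++ y :: v))) => [|y]; last by rewrite assoc.
ring.
Qed.

(** Starting from i > j > k, both ways of reaching k j i give the same value: the
    terms in which one bracket has been formed cancel up to a combination of
    iterated brackets, which is the color Jacobi identity. *)
Lemma straight_overlap u i j k v :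
  hb_lt j i -> hb_lt k j -> size (u ++ i :: j :: k :: v) = n.+1 ->
  (inv (u ++ i :: j :: k :: v) <= m)%N ->
  straight phi u i j (k :: v) = straight phi (u ++ [:: i]) j k v.
Proof.
move=> ji kj szw invm; rewrite /straight -!catA /=.
have ki : hb_lt k i.
  rewrite /hb_lt; apply: contra kj => ik; apply: hb_le_trans ik.
  by case/orP: (hb_le_total i j) => // ij; rewrite /hb_lt ij in ji.
have asc u' i' v' : (u' ++ [:: i']) ++ v' = u' ++ i' :: v' by rewrite -catA.
have i1 := inv_swap u (k :: v) ji.
have i2 := inv_swap (u ++ [:: j]) v ki; rewrite !asc in i2.
have i3 := inv_swap (u ++ [:: i]) v kj; rewrite !asc in i3.
have i4 := inv_swap u (j :: v) ki.
have sz x y z : size (u ++ x :: y :: z :: v) = n.+1.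
  by move: szw; rewrite !size_cat.
have -> : phi (u ++ j :: i :: k :: v) = straight phi (u ++ [:: j]) i k v.
  by rewrite -asc; apply: IH; rewrite ?asc //; lia.
have -> : phi (u ++ i :: k :: j :: v) = straight phi u i k (j :: v).
  by apply: IH => //; lia.
rewrite /straight !asc.
have -> : phi (u ++ j :: k :: i :: v) = straight phi u j k (i :: v).
  by apply: IH => //; lia.
have -> : phi (u ++ k :: i :: j :: v) = straight phi (u ++ [:: k]) i j v.
  by rewrite -asc; apply: IH; rewrite ?asc //; lia.
rewrite /straight !asc.
have ea l x : lin (fun y => phi ((u ++ [:: l]) ++ y :: v)) x =
  lin (fun y => phi (u ++ l :: y :: v)) x by apply: eq_lin => y; rewrite asc.
rewrite !ea.
have szn x y : (size (u ++ x :: y :: v) <= n)%N.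
  by move: szw; rewrite !size_cat /=; lia.
have hb2 x y := bracket_homog (hb_homog (h := B) x) (hb_homog (h := B) y).
(* Bring every single bracket next to the letters it meets, so that only
   iterated brackets are left to compare. *)
rewrite (compat_vecr low (hb2 j k) (szn i i)).
rewrite (compat_vecr low (hb2 i k) (szn j j)).
rewrite (compat_vecl low (hb2 i j) (szn k k)).
rewrite !bicharMr bicharMl.
rewrite (bracket_jacobi (b k) (hb_homog i) (hb_homog j)) linearB linearZ /=.
have := bicharC (d i) (d j).
set e1 := eps (d i) (d j); set e2 := eps (d j) (d i) => e12.
ring: e12.
Qed.

End Confluence.

(** It suffices to check one descent of each unsorted word: any other descent is
    either disjoint from it or overlaps it. *)
Lemma compat_confluence n phi : compat_upto n phi ->
  (forall w, size w = n.+1 -> (0 < inv w)%N -> exists u i j v,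
     [/\ w = u ++ i :: j :: v, hb_lt j i & compat_at phi u i j v]) ->
  compat_upto n.+1 phi.
Proof.
move=> low top.
suff main m u i j v : hb_lt j i -> size (u ++ i :: j :: v) = n.+1 ->
    (inv (u ++ i :: j :: v) < m)%N -> compat_at phi u i j v.
  move=> u i j v; rewrite leq_eqVlt => /orP[/eqP szw|]; last by rewrite ltnS; exact: low.
  have [ij|ji] := boolP (hb_le i j); last exact: main.
  have [ji|/main ij'] := boolP (hb_le j i).
    by have -> : i = j; [apply: hb_le_anti; rewrite ij | exact: compat_diag].
  apply/compat_sym/ij'; last exact: ltnSn.
  by move: szw; rewrite !size_cat.
elim: m u i j v => // m IHm u i j v ji szw; rewrite ltnS => invm.
have [|u' [i' [j' [v' [weq ji' cat']]]]] := top _ szw; first by rewrite inv_swap.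
have [szle|/ltnW szle] := leqP (size u') (size u).
  have [w [uE]] := cat_split (esym weq) szle.
  case: w uE => [|x [|y w]] uE /=.
  - by case=> ei ej ev; move: cat'; rewrite ei ej ev uE cats0.
  - case=> ex ey ev; subst x j' v'; rewrite /compat_at weq cat' uE.
    by apply: (straight_overlap low IHm); rewrite // -weq.
  - case=> ex ey ev; subst x y v'; rewrite /compat_at weq cat' uE.
    by apply: (straight_disjoint low IHm); rewrite // -weq.
have [w [uE]] := cat_split weq szle.
case: w uE => [|x [|y w]] uE /=.
- by case=> ei ej ev; move: cat'; rewrite -ei -ej -ev uE cats0.
- case=> ex ey ev; subst x i' v; rewrite /compat_at weq cat' uE.
  by symmetry; apply: (straight_overlap low IHm).
- case=> ex ey ev; subst x y v; rewrite /compat_at weq cat' uE.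
  by symmetry; apply: (straight_disjoint low IHm).
Qed.
Lemma inv_eq0 w : (inv w == 0%N) = sorted leB w.
Proof.
elim: w => //= i w IH; rewrite addn_eq0 IH (path_sortedE (@hb_le_trans _ _ _ _ B)).
congr (_ && _); rewrite eqn0Ngt -has_count -all_predC.
by apply: eq_all => j /=; rewrite /hb_lt negbK.
Qed.

Lemma descent_exists w : (0 < inv w)%N -> exists t : word * I * I * word,
  let: (u, i, j, v) := t in w = u ++ i :: j :: v /\ hb_lt j i.
Proof.
rewrite lt0n inv_eq0; elim: w => // i w IH /=.
case: w IH => [//|j w] IH /=; have [ij /= ns|ji _] := boolP (hb_le i j).
  by have [[[[u k] l] v] /= [-> lk]] := IH ns; exists (i :: u, k, l, v).
by exists ([::], i, j, w).
Qed.

(** An arbitrary descent; by confluence the choice does not matter. *)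
Definition descent w : option (word * I * I * word) :=
  if pselect (0 < inv w)%N is left h then Some (sval (cid (descent_exists h)))
  else None.

Lemma descentP w : (0 < inv w)%N -> exists u i j v,
  [/\ descent w = Some (u, i, j, v), w = u ++ i :: j :: v & hb_lt j i].
Proof.
move=> invw; rewrite /descent; case: pselect => // h.
by case: cid => -[[[u i] j] v] /= [wE ji]; exists u, i, j, v.
Qed.

Section Extension.
Variable f : word -> K.

(** Straightens m times, with f at the end and phi on the shorter words that
    appear.  Each step removes exactly one inversion, so m is meant to be the number
    of inversions of w, and the branch 0 is then never reached. *)
Fixpoint reduce (phi : word -> K) m w : K :=
  if m is m'.+1 then
    if descent w is Some (u, i, j, v) then
      e i j * reduce phi m' (u ++ j :: i :: v)
        + lin (fun k => phi (u ++ k :: v)) (bracket (b i) (b j))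
    else 0
  else f w.

(** The extension of f to words of length at most n, built one length at a
    time because straightening produces shorter words. *)
Fixpoint extend n : word -> K :=
  if n is n'.+1 then
    fun w => if size w == n then reduce (extend n') (inv w) w else extend n' w
  else f.

Lemma extend_stable n w : (size w <= n)%N -> extend n w = extend (size w) w.
Proof.
elim: n => [|n IH]; first by rewrite leqn0 => /eqP ->.
by rewrite leq_eqVlt => /predU1P[-> //|szw] /=; rewrite ltn_eqF // IH.
Qed.

Lemma extend_compat n : compat_upto n (extend n).
Proof.
elim: n => [|n IH]; first by move=> u i j v; rewrite size_cat /= addnS.
have stab w : (size w <= n)%N -> extend n.+1 w = extend n w.
  by move=> szw /=; rewrite ltn_eqF.
apply: compat_confluence.
  move=> u i j v szn; rewrite /compat_at /straight !stab //; last first.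
    by move: szn; rewrite !size_cat.
  rewrite IH //; congr (_ + _); apply: eq_lin => k; rewrite stab //.
  by move: szn; rewrite !size_cat /=; lia.
move=> w szw invw; have [u [i [j [v [dw wE ji]]]]] := descentP invw.
exists u, i, j, v; split=> //; rewrite /compat_at -wE [LHS]/= szw eqxx.
move: invw; case invE: (inv w) => [//|m] _ /=; rewrite dw /straight.
rewrite /= [size (u ++ j :: i :: v)](_ : _ = n.+1) ?eqxx; last first.
  by rewrite -szw wE !size_cat.
have -> : inv (u ++ j :: i :: v) = m.
  by move: invE; rewrite wE inv_swap // => -[].
congr (_ + _); apply: eq_lin => k; rewrite ltn_eqF //.
by rewrite ltnS -ltnS -szw wE !size_cat /= !addnS.
Qed.

(** The core of the Poincare-Birkhoff-Witt theorem: the values on sorted words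
    can be prescribed freely. *)
Lemma compat_extension :
  exists2 phi, compat phi & forall w, sorted leB w -> phi w = f w.
Proof.
exists (fun w => extend (size w) w); last first.
  by case=> // i w; rewrite -inv_eq0 => /eqP inv0 /=; rewrite eqxx -/(inv (i :: w)) inv0.
move=> u i j v; have := @extend_compat _ u i j v (leqnn _).
rewrite /compat_at /straight => ->; congr (_ * _ + _).
  by congr extend; rewrite !size_cat.
by apply: eq_lin => k; rewrite extend_stable // !size_cat /=; lia.
Qed.

End Extension.

(** Straightening terminates. *)
Lemma word_ind (P : word -> Prop) :
  (forall w, sorted leB w -> P w) ->
  (forall u i j v, hb_lt j i -> P (u ++ j :: i :: v) ->
     (forall k, P (u ++ k :: v)) -> P (u ++ i :: j :: v)) -> forall w, P w.
Proof.
move=> Ps Pd w; move: {2}(size w) (erefl (size w)) => n.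
elim: n w => [|n IHn] w; first by move=> /size0nil ->; apply: Ps.
move: {2}(inv w) (erefl (inv w)) => m; elim: m w => [|m IHm] w invw szw.
  by apply: Ps; rewrite -inv_eq0 invw.
have [|u [i [j [v [_ wE ji]]]]] := @descentP w; first by rewrite invw.
rewrite wE; apply: Pd => // [|k].
  by apply: IHm; [move: invw; rewrite wE inv_swap // => -[] | rewrite -szw wE !size_cat].
by apply: IHn; move: szw; rewrite wE !size_cat /= !addnS => -[].
Qed.

(** * Linear forms on the enveloping algebra *)

(** The enveloping algebra acts on functions on words by the transpose of
    concatenation on the left: the generator x sends phi to w |-> phi (x w).  Since
    it is a transpose, the product s t acts as s first, then t. *)
Fixpoint ev (t : uterm L) (phi : word -> K) : word -> K :=
  match t with
  | UGen x => fun w => lin (fun k => phi (k :: w)) x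
  | UCst a => fun w => a * phi w
  | UAdd s t => fun w => ev s phi w + ev t phi w
  | UMul s t => ev t (ev s phi)
  end.

Lemma ev_comb t a phi psi w :
  ev t (fun w => a * phi w + psi w) w = a * ev t phi w + ev t psi w.
Proof.
elim: t phi psi w => [x|c|s IHs t IHt|s IHs t IHt] phi psi w /=.
- exact: lin_comb.
- by rewrite mulrDr mulrCA.
- by rewrite IHs IHt mulrDr addrACA.
- rewrite -IHt; congr (ev t _ w); apply/funext => v; exact: IHs.
Qed.

Lemma ev0 t w : ev t (fun=> 0) w = 0.
Proof.
have := ev_comb t (-1) (fun=> 0) (fun=> 0) w.
rewrite (_ : (fun w => -1 * 0 + 0) = (fun=> 0)); last first.
  by apply/funext => v; rewrite mulr0 addr0.
by rewrite mulN1r addNr.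
Qed.

Lemma evZ t a phi w : ev t (fun w => a * phi w) w = a * ev t phi w.
Proof.
rewrite -[RHS]addr0 -(ev0 t w) -ev_comb; congr (ev t _ w).
by apply/funext => v; rewrite addr0.
Qed.

Lemma evD t phi psi w : ev t (fun w => phi w + psi w) w = ev t phi w + ev t psi w.
Proof.
rewrite -[ev t phi w]mul1r -ev_comb; congr (ev t _ w).
by apply/funext => v; rewrite mul1r.
Qed.

Lemma ev_compat t phi : compat phi -> compat (ev t phi).
Proof.
elim: t phi => [x|c|s IHs t IHt|s IHs t IHt] phi cphi u i j v.
- rewrite /compat_at /straight /= lin_exchange -linZl -linDl.
  by apply: eq_lin => k; rewrite -!cat_cons cphi.
- by rewrite /compat_at /straight /= cphi /straight linZl; ring.
- rewrite /compat_at /straight /= (IHs phi cphi) (IHt phi cphi) /straight linDl.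
  by ring.
- exact/IHt/IHs.
Qed.

(** The action only satisfies the defining relations of the enveloping algebra
    on compatible functions, which form a stable subspace by [ev_compat]. *)
Lemma ev_cong s t phi : compat phi -> ucong s t -> ev s phi = ev t phi.
Proof.
move=> cphi st; elim: st phi cphi => {s t} /=.
- by [].
- by move=> u v _ IH phi cphi; rewrite IH.
- by move=> u v w _ IH1 _ IH2 phi cphi; rewrite IH1 // IH2.
- by move=> u u' v v' _ IH1 _ IH2 phi cphi; rewrite IH1 // IH2.
- move=> u u' v v' _ IH1 _ IH2 phi cphi; rewrite IH1 // IH2 //; exact: ev_compat.
- by move=> u v w phi cphi; apply/funext => s; rewrite addrA.
- by move=> u v phi cphi; apply/funext => s; rewrite addrC.
- by move=> u phi cphi; apply/funext => s; rewrite mul0r add0r.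
- by move=> u phi cphi; apply/funext => s; rewrite evZ mulN1r addNr mul0r.
- by [].
- by move=> u phi cphi; congr ev; apply/funext => s; rewrite mul1r.
- by move=> u v w phi cphi; apply/funext => s; rewrite evD.
- by [].
- by move=> a a' phi cphi; apply/funext => s; rewrite mulrDl.
- by move=> a a' phi cphi; apply/funext => s; rewrite [a * a']mulrC mulrA.
- by move=> a u phi cphi; apply/funext => s; rewrite evZ.
- by move=> a x y phi cphi; apply/funext => s; rewrite linearP linZl.
- move=> g h x y gx hy phi cphi; apply/funext => s.
  rewrite lin_exchange; elim/homog_ind: gx => [|a z t IHz IHt|i di].
  + by rewrite bracket0l !linear0 addr0.
  + by rewrite bracketPl !linearP IHz IHt; ring.
  + rewrite !linE linZl -di.
    have cn n : compat_upto n phi by move=> u j k v _; exact: cphi.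
    exact: (@compat_vecr _ phi [::] i s h y (cn _) hy (leqnn _)).
Qed.

Definition mon w : envalg L := \prod_(i <- w) ugen (b i).

(** Send an element of the enveloping algebra to the value at the empty word
    of its action on phi. *)
Lemma compat_functional phi : compat phi ->
  exists F : {scalar envalg L}, forall w, F (mon w) = phi w.
Proof.
move=> cphi; pose F (x : envalg L) : K := ev (repr x) phi [::].
have FE t : F (uclass t) = ev t phi [::].
  rewrite /F (@ev_cong _ t) //; apply/uclassP; exact: reprK.
have Flin : linear (F : envalg L -> K^o).
  move=> a x y; have [s ->] := urepr x; have [t ->] := urepr y.
  rewrite -[a *: _ + _]/(uadd (umul (ucst _ _) _) _) /ucst umulE uaddE !FE /= evZ.
  by [].
pose F' : {scalar envalg L} := HB.pack F
  (GRing.isLinear.Build K (envalg L) K _ F Flin).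
exists F' => w; rewrite /F' /=.
suff [t <- tE] : exists2 t, uclass t = mon w & forall psi v, ev t psi v = psi (w ++ v).
  by rewrite FE tE cats0.
elim: w => [|i w [t tE evE]].
  by exists (UCst L 1); [rewrite /mon big_nil | move=> psi v /=; rewrite mul1r].
exists (UMul (UGen (b i)) t); first by rewrite -umulE tE /mon big_cons.
by move=> psi v /=; rewrite evE linE.
Qed.
(** * The order on words *)

(** A strict order on words up to permutation.  Length comes first, so that
    the bracket terms produced by straightening a word are smaller than it; ties are decided
    by the largest letter whose multiplicities differ, a rule that is invariant
    under adding letters on both sides. *)
Definition word_lt u v := (size u < size v)%N \/ size u = size v /\
  exists i, (count_mem i u < count_mem i v)%N /\
    forall j, hb_lt i j -> count_mem j u = count_mem j v.

Lemma word_lt_perm u u' v v' : perm_eq u u' -> perm_eq v v' -> word_lt u v -> word_lt u' v'.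
Proof.
move=> uu' vv'; rewrite /word_lt (perm_size uu') (perm_size vv') => -[?|[szE [i [ci cj]]]].
  by left.
right; split=> //; exists i; rewrite -(permP uu') -(permP vv'); split=> // j /cj.
by rewrite -(permP uu') -(permP vv').
Qed.

Lemma word_lt_irr u v : perm_eq u v -> ~ word_lt u v.
Proof.
move=> uv [|[_ [i [+ _]]]]; first by rewrite (perm_size uv) ltnn.
by rewrite (permP uv) ltnn.
Qed.

Lemma hb_le_refl i : hb_le i i.
Proof. by case/orP: (hb_le_total i i). Qed.

Lemma hb_ltW i j : hb_lt i j -> hb_le i j.
Proof. by rewrite /hb_lt; case/orP: (hb_le_total i j) => -> //. Qed.

Lemma hb_lt_le_trans j i k : hb_lt i j -> hb_le j k -> hb_lt i k.
Proof. by move=> ij jk; apply: contra ij => ki; exact: hb_le_trans ki. Qed.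

Lemma hb_le_lt_trans j i k : hb_le i j -> hb_lt j k -> hb_lt i k.
Proof. by move=> ij; apply: contra => ki; exact: hb_le_trans ij. Qed.

Lemma word_lt_trans v u w : word_lt u v -> word_lt v w -> word_lt u w.
Proof.
rewrite /word_lt => -[uv|[uv [i [ci hi]]]] [vw|[vw [j [cj hj]]]].
- by left; exact: ltn_trans vw.
- by left; rewrite -vw.
- by left; rewrite uv.
right; split; first by rewrite uv.
have [ij|ji] := boolP (hb_lt i j).
  exists j; rewrite hi //; split=> // k jk; rewrite hi ?hj //.
  exact: hb_lt_le_trans ij (hb_ltW jk).
move: ji; rewrite /hb_lt negbK => ji; exists i; split.
  have [ij|ij] := boolP (hb_le i j); last by rewrite -hj.
  have ijE : i = j by apply: hb_le_anti; rewrite ij ji.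
  by rewrite (ltn_trans ci) // ijE.
by move=> k ik; rewrite hi // hj //; exact: hb_le_lt_trans ji ik.
Qed.

Lemma word_lt_cat u w v v' : word_lt v v' -> word_lt (u ++ v ++ w) (u ++ v' ++ w).
Proof.
rewrite /word_lt !size_cat => -[?|[vv [i [ci hi]]]]; first by left; lia.
right; split; first by lia.
exists i; rewrite !count_cat; split; first by lia.
by move=> j /hi; rewrite !count_cat => ->.
Qed.

(** Take the largest letter whose multiplicities differ. *)
Lemma word_lt_total u v : [\/ perm_eq u v, word_lt u v | word_lt v u].
Proof.
have [uv|uv|szE] := ltngtP (size u) (size v).
- by apply: Or32; left.
- by apply: Or33; left.
have [puv|npuv] := boolP (perm_eq u v); first by apply: Or31.
pose s := [seq i <- u ++ v | count_mem i u != count_mem i v].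
have s0 : s != [::].
  apply: contra npuv => s0; apply/allP => i iuv /=; apply/negPn/negP => ci.
  by have := in_nil i; rewrite -(eqP s0) mem_filter ci iuv.
have [i] := ex_max (hb_le_total (h := B)) (@hb_le_trans _ _ _ _ B) s0.
rewrite mem_filter => /andP[ci _] imax.
have above j : hb_lt i j -> count_mem j u = count_mem j v.
  move=> ij; apply/eqP/negPn/negP => cj.
  have : j \in u ++ v.
    apply: contraR cj; rewrite mem_cat negb_or.
    by case/andP=> /count_memPn -> /count_memPn ->.
  move=> juv; move: ij; rewrite /hb_lt imax // mem_filter; by rewrite cj.
move: ci; case: ltngtP => // ci _; [apply: Or32 | apply: Or33]; right; split=> //.
  by exists i.
by exists i; split=> // j /above.
Qed.

(** * Leading terms *)

Lemma mon_cat u v : mon (u ++ v) = mon u * mon v.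
Proof. exact: big_cat. Qed.

Lemma mon_cons i v : mon (i :: v) = ugen (b i) * mon v.
Proof. exact: big_cons. Qed.

Lemma mon_gen i : mon [:: i] = ugen (b i).
Proof. exact: big_seq1. Qed.

Lemma mon_nil : mon [::] = 1. Proof. exact: big_nil. Qed.

Lemma span_mul (P Q S : word -> Prop) x y :
  (forall u v, P u -> Q v -> S (u ++ v)) ->
  lspan P mon x -> lspan Q mon y -> lspan S mon (x * y).
Proof.
move=> h Px Qy; elim: Px => [|a u z Pu _ IH]; first by rewrite mul0r; exact: lspan0.
rewrite mulrDl; apply: lspanD IH; rewrite -scalerAl; apply: lspanZ.
elim: Qy => [|c v t Qv _ IH]; first by rewrite mulr0; exact: lspan0.
rewrite mulrDr; apply: lspanD IH; rewrite -scalerAr -mon_cat.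
exact/lspanZ/lspan_gen/h.
Qed.

Lemma mon_in (w : word) : lspan (eq^~ w) mon (mon w).
Proof. exact: lspan_gen. Qed.

Lemma ugen_span x : lspan (fun w => size w = 1%N) mon (ugen x).
Proof.
elim/basis_ind: x => [|a x y IHx IHy|i]; first by rewrite linear0; exact: lspan0.
  by rewrite linearP; apply: lspanD IHy; exact: lspanZ.
by rewrite -mon_gen; exact: lspan_gen.
Qed.

(** Generation by sorted monomials: straighten words by [word_ind]. *)
Lemma sorted_span z : lspan (sorted leB) mon z.
Proof.
have [t ->] := urepr z.
suff: lspan (fun=> True) mon (uclass t).
  apply: lspan_le => w _; elim/word_ind: w => [w sw|u i j v _ IH1 IH2]; first exact: lspan_gen.
  have -> : mon (u ++ i :: j :: v) =
      e i j *: mon (u ++ j :: i :: v) + mon u * ugen (bracket (b i) (b j)) * mon v.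
    rewrite -(ugen_rel (hb_homog i) (hb_homog j)) !mon_cat !mon_cons mulrBr mulrBl.
    by rewrite -scalerAr -scalerAl addrC !mulrA subrK.
  apply: lspanD; first exact: lspanZ.
  elim/basis_ind: (bracket _ _) => [|a x y IHx IHy|k].
  - by rewrite linear0 mulr0 mul0r; exact: lspan0.
  - rewrite linearP mulrDr mulrDl -scalerAr -scalerAl; apply: lspanD IHy; exact: lspanZ.
  - by have := IH2 k; rewrite mon_cat mon_cons mulrA.
elim: t => [x|a|s IHs t IHt|s IHs t IHt].
- by apply: lspan_sub (ugen_span x).
- have -> : uclass (UCst L a) = a *: 1 by rewrite -[LHS]mulr1.
  by rewrite -mon_nil; exact/lspanZ/lspan_gen.
- by rewrite -uaddE; exact: lspanD.
- by rewrite -umulE; exact: span_mul IHs IHt.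
Qed.

(** Spanned by the monomials of all smaller words, sorted or not; this makes
    the product of two such spans immediate to control. *)
Definition lower w := lspan (fun t => word_lt t w) mon.

(** Linear independence: extend the indicator function of the sorted
    rearrangement of w.  It vanishes on smaller words, because straightening never
    increases a word, and is a nonzero scalar on every rearrangement of w. *)
Lemma mon_notin_lower w : ~ lower w (mon w).
Proof.
pose s := sort leB w.
have sw : perm_eq s w by exact/permPl/perm_sort.
have ss : sorted leB s by apply: sort_sorted; exact: hb_le_total.
have [phi cphi phiE] := compat_extension (fun t => (t == s)%:R).
have phiP t : (size t <= size s)%N ->
    if perm_eq t s then phi t != 0 else phi t == 0.
  elim/word_ind: t => [t st _|u i j v ji IH1 IH2 szt].
    rewrite phiE //; case: ifPn => [pts|npts].
      have -> : t = s by apply: (sorted_eq (@hb_le_trans _ _ _ _ B) (@hb_le_anti _ _ _ _ B)).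
      by rewrite eqxx oner_neq0.
    by case: (t =P s) => [ts|_ //]; rewrite ts perm_refl in npts.
  rewrite cphi /straight (@eq_lin _ (fun=> 0)) ?lin0 ?addr0 => [|k]; last first.
    have szk : (size (u ++ k :: v) < size s)%N.
      by move: szt; rewrite !size_cat /=; lia.
    have := IH2 k (ltnW szk); case: ifP => [/perm_size szE|_ /eqP //].
    by move: szk; rewrite szE ltnn.
  have -> : perm_eq (u ++ i :: j :: v) s = perm_eq (u ++ j :: i :: v) s.
    have : perm_eq (u ++ i :: j :: v) (u ++ j :: i :: v).
      by rewrite perm_cat2l; exact/permPl/(perm_catCA [:: i] [:: j] v).
    by move/permPl.
  have {}szt : (size (u ++ j :: i :: v) <= size s)%N by move: szt; rewrite !size_cat.
  have := IH1 szt.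
  case: ifP => _ phi0; first by rewrite mulf_neq0 ?bichar_neq0.
  by rewrite mulf_eq0 phi0 orbT.
have [F FE] := compat_functional cphi.
move=> lw; have F0 : F (mon w) = 0.
  elim: lw => [|a t z tw _ IH]; first by rewrite linear0.
  rewrite linearP IH FE addr0.
  have szt : (size t <= size s)%N.
    by rewrite (perm_size sw); case: tw => [/ltnW //|[-> _]].
  have := phiP t szt; case: ifP => [pts _|_ /eqP -> ]; last by rewrite mulr0.
  by case: (word_lt_irr _ tw); apply: perm_trans pts sw.
have := phiP w; rewrite (perm_size sw) leqnn perm_sym sw -FE F0 eqxx.
by move/(_ isT).
Qed.
Lemma lower_trans u w x : word_lt u w -> lower u x -> lower w x.
Proof. by move=> uw; apply: lspan_sub => t tu; exact: word_lt_trans uw. Qed.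

Lemma mon_lower u w : word_lt u w -> lower w (mon u).
Proof. by move=> uw; exact: lspan_gen. Qed.

Lemma lower_mulr w x u : lower w x -> lower (w ++ u) (x * mon u).
Proof.
move=> lx; apply: span_mul lx (mon_in u) => s t sw ->.
exact: (word_lt_cat [::]).
Qed.

Lemma lower_mull w x u : lower w x -> lower (u ++ w) (mon u * x).
Proof.
move=> lx; apply: span_mul (mon_in u) lx => t s -> sw.
by have := word_lt_cat u [::] sw; rewrite !cats0.
Qed.

Lemma lower_mul u w x y : lower u x -> lower w y -> lower (u ++ w) (x * y).
Proof.
move=> lx ly; apply: span_mul lx ly => s t su tw.
apply: (@word_lt_trans (u ++ t)); first exact: (word_lt_cat [::]).
by have := word_lt_cat u [::] tw; rewrite !cats0.
Qed.

Lemma bicharVl g h : eps g^-1%g h = (eps g h)^-1.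
Proof.
apply: (mulfI (bichar_neq0 eps g h)).
by rewrite -bicharMl mulgV bichar1l mulfV ?bichar_neq0.
Qed.

(** The word w is only determined up to permutation, and c then changes by the
    scalar computed in [lead_swap]. *)
Definition lead z w c := c != 0 /\ lower w (z - c *: mon w).

Lemma lead_neq0 z w c : lead z w c -> z <> 0.
Proof.
move=> [c0 + z0]; rewrite z0 sub0r => /lspanN/(lspanZ c^-1).
by rewrite opprK scalerA mulVf // scale1r; exact: mon_notin_lower.
Qed.

Lemma lead_not_lower z w c : lead z w c -> ~ lower w z.
Proof.
move=> [c0 lz] lz'; apply: (@mon_notin_lower w).
have := lspanZ c^-1 (lspanB lz' lz).
by rewrite subKr scalerA mulVf // scale1r.
Qed.

Lemma lead_perm z u w c c' : lead z u c -> lead z w c' -> perm_eq u w.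
Proof.
have aux u' w' a a' : lead z u' a -> lead z w' a' -> ~ word_lt u' w'.
  move=> [a0 lu'] lw' uw; apply: (lead_not_lower lw'); rewrite -[z](subrK (a *: mon u')).
  by apply: lspanD (lower_trans uw lu') _; exact/lspanZ/mon_lower.
by move=> lu lw; case: (word_lt_total u w) => // [/(aux _ _ _ _ lu lw)|/(aux _ _ _ _ lw lu)].
Qed.

Lemma lead_coef z w c c' : lead z w c -> lead z w c' -> c = c'.
Proof.
move=> [c0 l1] [c0' l2]; apply: contrapT => /eqP; rewrite -subr_eq0 => cc.
apply: (@mon_notin_lower w); have := lspanZ (c - c')^-1 (lspanB l2 l1).
rewrite [z - _ - _](_ : _ = (c - c') *: mon w).
  by rewrite scalerA mulVf // scale1r.
by rewrite opprB addrC addrA subrK scalerBl.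
Qed.

Lemma lead_mul x y u w a c : lead x u a -> lead y w c ->
  lead (x * y) (u ++ w) (a * c).
Proof.
move=> [a0 lx] [c0 ly]; split; first exact: mulf_neq0.
have -> : x * y - (a * c) *: mon (u ++ w) =
    (x - a *: mon u) * (y - c *: mon w) + c *: ((x - a *: mon u) * mon w)
      + a *: (mon u * (y - c *: mon w)).
  rewrite scalerAr -mulrDr subrK scalerAl mulrBl mulrBr addrA subrK mon_cat.
  by rewrite -scalerAl -scalerAr scalerA.
apply: lspanD; last exact/lspanZ/lower_mull.
by apply: lspanD; [exact: lower_mul | exact/lspanZ/lower_mulr].
Qed.

Lemma lead_mon w : lead (mon w) w 1.
Proof. by split; rewrite ?oner_neq0 // scale1r subrr; exact: lspan0. Qed.

(** Among the sorted monomials of an expansion, distinct ones are strictly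
    comparable, so one of them dominates all the others. *)
Lemma lead_exists z : z <> 0 ->
  exists w c, sorted leB w /\ lead z w c.
Proof.
move=> z0; have [s [c [us ss sc zE]]] := lspan_uniq (sorted_span z).
pose R u v := `[< word_lt u v \/ perm_eq u v >].
have Rtot : total R.
  move=> u v; case: (word_lt_total u v) => h; apply/orP.
  - by left; apply/asboolP; right.
  - by left; apply/asboolP; left.
  - by right; apply/asboolP; left.
have Rtr : transitive R.
  move=> v u w /asboolP uv /asboolP vw; apply/asboolP.
  case: uv vw => [uv|uv] [vw|vw].
  - by left; exact: word_lt_trans vw.
  - by left; exact: word_lt_perm vw uv.
  - by left; apply: word_lt_perm vw => //; rewrite perm_sym.
  - by right; exact: perm_trans vw.
have [|w ws wmax] := ex_max Rtot Rtr (s := s).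
  by apply/eqP => s0; apply: z0; rewrite zE s0 big_nil.
exists w, (c w); split; first exact: ss.
split; first exact: sc.
rewrite zE (bigD1_seq w) //= addrAC subrr add0r big_seq_cond.
apply: lspan_sum => t /andP[ts ntw]; apply/lspanZ/mon_lower.
have /asboolP[//|ptw] := wmax _ ts.
have tw : t = w.
  by apply: (sorted_eq (@hb_le_trans _ _ _ _ B) (@hb_le_anti _ _ _ _ B)); rewrite ?ss.
by rewrite tw eqxx in ntw.
Qed.

Lemma envalg_domain (x y : envalg L) : x * y = 0 -> x = 0 \/ y = 0.
Proof.
move=> xy0; have [|/eqP x0] := eqVneq x 0; first by left.
have [|/eqP y0] := eqVneq y 0; first by right.
have [u [a [_ lx]]] := lead_exists x0; have [w [c [_ ly]]] := lead_exists y0.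
by case: (lead_neq0 (lead_mul lx ly)).
Qed.

Fixpoint word_deg w : G := if w is i :: w' then (d i * word_deg w')%g else 1%g.

Definition shorter n := lspan (fun t => (size t < n)%N) mon.

Lemma mon_swap1 i v : shorter (size v).+1
  (ugen (b i) * mon v - eps (d i) (word_deg v) *: (mon v * ugen (b i))).
Proof.
elim: v => [|j v IH] /=.
  by rewrite mon_nil bichar1r mulr1 mul1r scale1r subrr; exact: lspan0.
rewrite mon_cons bicharMr -scalerA.
have -> : ugen (b i) * (ugen (b j) * mon v) -
    e i j *: (eps (d i) (word_deg v) *: (ugen (b j) * mon v * ugen (b i))) =
    ugen (bracket (b i) (b j)) * mon v + e i j *: (ugen (b j) *
      (ugen (b i) * mon v - eps (d i) (word_deg v) *: (mon v * ugen (b i)))).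
  rewrite -(ugen_rel (hb_homog i) (hb_homog j)) mulrBl mulrBr scalerBr.
  by rewrite -!scalerAl -!scalerAr !mulrA addrA subrK.
apply: lspanD.
  by apply: span_mul (ugen_span _) (mon_in v) => s t s1 ->; rewrite size_cat s1.
apply: lspanZ; rewrite -mon_gen; apply: span_mul (mon_in _) IH => s t -> /=.
by rewrite !ltnS.
Qed.

(** Two monomials commute up to the bicharacter of their degrees, modulo words
    that are shorter because a bracket replaces two letters by one. *)
Lemma mon_swap u v : shorter (size u + size v)
  (mon u * mon v - eps (word_deg u) (word_deg v) *: (mon v * mon u)).
Proof.
elim: u => [|i u IH] /=.
  by rewrite mon_nil bichar1l mulr1 mul1r scale1r subrr; exact: lspan0.
rewrite mon_cons bicharMl mulrC -scalerA.
set X := ugen (b i); set c := eps (d i) _; set c' := eps (word_deg u) _.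
have -> : X * mon u * mon v - c' *: (c *: (mon v * (X * mon u))) =
    X * (mon u * mon v - c' *: (mon v * mon u))
      + c' *: ((X * mon v - c *: (mon v * X)) * mon u).
  rewrite mulrBr mulrBl scalerBr -!scalerAl -!scalerAr !mulrA addrA subrK.
  by [].
apply: lspanD.
  rewrite /X -mon_gen; apply: span_mul (mon_in _) IH => s t -> /=.
  by rewrite addSn !ltnS.
apply: lspanZ; apply: span_mul (mon_swap1 i v) (mon_in _) => s t szs ->.
by rewrite size_cat; lia.
Qed.

Lemma shorter_lower w n x : (n <= size w)%N -> shorter n x -> lower w x.
Proof. by move=> nw; apply: lspan_sub => t tn; left; exact: leq_trans nw. Qed.

Lemma lead_swap z u v w c : lead z (u ++ v ++ w) c ->
  lead z (v ++ u ++ w) (c * eps (word_deg u) (word_deg v)).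
Proof.
move=> [c0 lz]; split; first by rewrite mulf_neq0 ?bichar_neq0.
set ep := eps _ _.
have -> : z - (c * ep) *: mon (v ++ u ++ w) = (z - c *: mon (u ++ v ++ w)) +
    c *: ((mon u * mon v - ep *: (mon v * mon u)) * mon w).
  rewrite !mon_cat mulrBl scalerBr -!scalerAl scalerA !mulrA addrA subrK.
  by [].
apply: lspanD.
  apply: lspan_sub lz => t; apply: word_lt_perm => //; exact/permPl/perm_catCA.
apply/lspanZ/(@shorter_lower _ (size u + size v + size w)).
  by rewrite !size_cat; lia.
apply: span_mul (mon_swap u v) (mon_in w) => s t szs ->.
by rewrite size_cat ltn_add2r.
Qed.

Lemma lead_swap_cat z u v c : lead z (u ++ v) c ->
  lead z (v ++ u) (c * eps (word_deg u) (word_deg v)).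
Proof. by have := @lead_swap z u v [::] c; rewrite !cats0. Qed.

(** * Consequences of the generalized identity *)

Section GeneralizedIdentity.
Variables (sigma : envalg L -> envalg L) (x y x' : envalg L).
Hypotheses (sigma1 : sigma 1 = 1) (x0 : x <> 0) (y0 : y <> 0) (x'0 : x' <> 0).
Hypothesis gpi : forall r, x * sigma r * y = y * r * x'.

(** The identity at r = 1 shows that x and x' have the same leading word u, and
    that their leading coefficients differ by the scalar by which u commutes with
    the leading word v of y.  At r = x_i,
    cancelling u and v leaves x_i as the leading word of its image.  Moving this
    letter to the front past u on one side and past v on the other side determines
    the coefficient. *)
Lemma gpi_leading_gen : exists h, forall i,
  lower [:: i] (sigma (ugen (b i)) - eps h (d i) *: ugen (b i)).
Proof.
have [u [a [su lx]]] := lead_exists x0.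
have [v [c [sv ly]]] := lead_exists y0.
have [u' [a' [su' lx']]] := lead_exists x'0.
have gpi1 := gpi 1; rewrite sigma1 !mulr1 in gpi1.
have lxy := lead_mul lx ly; have lyx' := lead_mul ly lx'.
rewrite -gpi1 in lyx'.
have uu' : u = u'.
  apply: (sorted_eq (@hb_le_trans _ _ _ _ B) (@hb_le_anti _ _ _ _ B)) => //.
  by have := lead_perm lxy lyx'; rewrite perm_catC perm_cat2l.
subst u'; have ac := lead_coef (lead_swap_cat lxy) lyx'.
exists (word_deg v / word_deg u)%g => i.
have l2 := lead_mul (lead_mul ly (lead_mon [:: i])) lx'.
rewrite mon_gen -gpi in l2.
have si0 : sigma (ugen (b i)) <> 0.
  by move=> si0; case: (lead_neq0 l2); rewrite si0 mulr0 mul0r.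
have [w [q [sw lsi]]] := lead_exists si0.
have l1 := lead_mul (lead_mul lx lsi) ly.
have wi : perm_eq w [:: i].
  by apply/permP => p; have /permP/(_ p) := lead_perm l1 l2; rewrite !count_cat; lia.
have {}wi : w = [:: i].
  by apply: perm_small_eq.
subst w; case: lsi => q0; rewrite mon_gen.
suff -> : q = eps (word_deg v / word_deg u)%g (d i) by [].
rewrite -catA in l1; have {}l1 := lead_swap_cat l1.
rewrite -catA in l2; have {}l2 := lead_swap l2.
have := lead_coef l1 l2; rewrite /= mulg1 bicharMr mulr1 -ac -!mulrA => /(mulfI lx.1).
rewrite !mulrA [q * c]mulrC -!mulrA => /(mulfI ly.1) => e1.
have {}e1 : q * eps (word_deg u) (d i) = eps (word_deg v) (d i).
  apply: (mulIf (bichar_neq0 eps (word_deg u) (word_deg v))).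
  by rewrite -mulrA e1 mulrC.
by rewrite bicharMl bicharVl -e1 mulfK ?bichar_neq0.
Qed.
End GeneralizedIdentity.

(** Shows that 1 and the basis elements of L are linearly independent in the
    enveloping algebra. *)
Lemma affine_functional f c : exists F : {scalar envalg L},
  (forall x, F (ugen x) = lin f x) /\ F 1 = c.
Proof.
have [phi cphi phiE] := compat_extension (fun w => if w is i :: _ then f i else c).
have [F FE] := compat_functional cphi; exists F; split; last by rewrite -mon_nil FE phiE.
elim/basis_ind => [|a x y IHx IHy|i]; first by rewrite !linear0.
  by rewrite !linearP /= IHx IHy.
by rewrite -mon_gen FE phiE // linE.
Qed.

Lemma lower_gen i z : lower [:: i] z -> exists y a,
  lspan (fun j => hb_lt j i) b y /\ z = ugen y + a%:A.
Proof.
elim=> [|a t x ti _ [y [c [yi ->]]]].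
  by exists 0, 0; rewrite linear0 scale0r addr0; split=> //; exact: lspan0.
case: ti => [|[]]; first by rewrite ltnS leqn0 => /nilP ->; exists y, (a + c);
  split=> //; rewrite mon_nil scalerDl addrCA.
case: t => [//|j [|//]] _ [m [cm above]]; exists (a *: b j + y), c; split; last first.
  by rewrite mon_gen linearP addrA.
apply: lspanS => //; move: cm above; rewrite /= !addn0.
case: (j =P m) => [_|jm]; first by case: (i == m).
case: eqP => // im _ above; rewrite -{}im {m} in jm above *.
rewrite /hb_lt; apply/negP => ij; apply: jm; apply: hb_le_anti; rewrite ij andbT.
apply: contrapT => /negP ji; have := above j ji; rewrite !addn0 eqxx.
case: (i =P j) => // ijE _; move: ji; rewrite ijE.
by case/orP: (hb_le_total j j) => ->.
Qed.

End PBW.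

(** For x in the domain of w, the relation (x (sigma r)) w = (x w) r holds after
    multiplication by a nonzero y from the ideal on which it is given, hence it
    holds outright.  Evaluating w at p * sigma r * p, once by left linearity and
    once by this relation, gives the identity with x = p and y = p w. *)
Lemma X_inner_gpi (R : nzRingType) (sigma : {rmorphism R -> R}) :
    (forall x y : R, x * y = 0 -> x = 0 \/ y = 0) -> bijective sigma -> X_inner sigma ->
  exists x y x' : R, [/\ x <> 0, y <> 0, x' <> 0 &
    forall r, x * sigma r * y = y * r * x'].
Proof.
move=> dom [tau sigmaK tauK] [w [_ _ w0 wsigma]].
have D := mdomP w.
have D0 : mdom w 0.
  by have [x Dx _] := ideal_neq0 D; rewrite -(subrr x); exact: (Defs.idealB D Dx Dx).
have wmul x r : mdom w x -> mfun w (x * sigma r) = mfun w x * r.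
  move=> Dx; have [J [JI Jw _ JE]] := wsigma r.
  have [y Jy y0] := ideal_neq0 JI.
  have /JE /= : J (y * x) by exact: (Defs.idealMr JI _ Jy).
  rewrite -mulrA (mfunM y (Defs.idealMr D (sigma r) Dx)) (mfunM y Dx).
  move=> /eqP; rewrite -mulrA -subr_eq0 -mulrBr => /eqP /dom[yE|/eqP].
    by rewrite yE eqxx in y0.
  by rewrite subr_eq0 => /eqP.
have [p [Dp wp0]] : exists p, mdom w p /\ mfun w p <> 0.
  apply: contrapT => no; apply: w0; exists (mdom w); split=> //.
  move=> z Dz /=; rewrite mulr0; apply: contrapT => wz; apply: no; by exists z.
have p0 : p <> 0.
  by move=> pE; apply: wp0; rewrite pE -(mul0r 0) mfunM ?mul0r.
exists p, (mfun w p), (tau p); split=> // [tp|r].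
  by apply: p0; rewrite -(tauK p) tp rmorph0.
rewrite -mfunM // -[X in mfun w (_ * X)]tauK -mulrA -rmorphM wmul //.
by rewrite mulrA.
Qed.

(** Transparent, so that the two bases share their index set and vectors. *)
Definition hb_rev (K : fieldType) (G : groupType) (eps : altBicharacter K G)
    (L : lieColorAlgebra eps) (B : homogBasis L) : homogBasis L.
Proof.
refine (@HomogBasis _ _ _ L (hbI B) (@hb _ _ _ _ B) (@hbdeg _ _ _ _ B)
  (fun i j => hb_le j i) _ _ _ (@hb_neq0 _ _ _ _ B) (@hb_homog _ _ _ _ B)
  (@hb_span _ _ _ _ B) (@hb_coord _ _ _ _ B)).
- by move=> i j; exact: hb_le_total.
- by move=> i j /andP[ij ji]; apply: hb_le_anti; rewrite ij ji.
- by move=> i j k ji ki; exact: hb_le_trans ji.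
Defined.

Section IdentityConsequences.
Variables (K : fieldType) (G : groupType) (eps : altBicharacter K G).
Variable L : lieColorAlgebra eps.
Hypothesis evenL : even_lca L.
Variable sigma : {rmorphism envalg L -> envalg L}.
Variables x y x' : envalg L.
Hypotheses (x0 : x <> 0) (y0 : y <> 0) (x'0 : x' <> 0).
Hypothesis gpi : forall r, x * sigma r * y = y * r * x'.
Variable B : homogBasis L.

(** Only additivity and multiplicativity are given; the identity itself forces
    sigma to fix the scalars, because these are central. *)
Lemma gpi_scalable a z : sigma (a *: z) = a *: sigma z.
Proof.
rewrite -[a *: z]mulr_algl rmorphM -[RHS]mulr_algl; congr (_ * _).
apply/eqP; rewrite -subr_eq0; apply/eqP.
have gpi1 : x * y = y * x' by have := gpi 1; rewrite rmorph1 !mulr1.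
have : x * (sigma a%:A - a%:A) * y = 0.
  by rewrite mulrBr mulrBl gpi !mulr_algr -!scalerAl gpi1 subrr.
by move=> /(envalg_domain evenL B)[/(envalg_domain evenL B)[]|].
Qed.

(** The two orders on the basis confine the remaining linear part to letters
    smaller than x_i and to letters larger than x_i, so it is zero. *)
Lemma gpi_affine : exists h, forall g z, homog L g z ->
  exists a, sigma (ugen z) = eps h g *: ugen z + a%:A.
Proof.
have [h hP] := gpi_leading_gen evenL B (rmorph1 sigma) x0 y0 x'0 gpi.
have [h' hP'] := gpi_leading_gen evenL (hb_rev B) (rmorph1 sigma) x0 y0 x'0 gpi.
exists h => g z; elim/(homog_ind (B := B)) => {z} [|a z t [c sz] [c' st]|i <-].
- by exists 0; rewrite linear0 rmorph0 scaler0 scale0r addr0.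
- exists (a * c + c'); rewrite !linearP /= rmorphD gpi_scalable sz st.
  rewrite !scalerDr !scalerA scalerDl mulrC addrACA; congr (_ + _).
have [u [a [ui uE]]] := lower_gen (hP i).
have [v [c [vi vE]]] := lower_gen (hP' i).
suff u0 : u = 0.
  by exists a; move: uE; rewrite u0 linear0 add0r => <-; rewrite addrC subrK.
have [s [m [us si mi uE']]] := lspan_uniq ui.
have coord0 j : hb_lt j i -> lin (B := B) (fun k => (k == j)%:R) u = 0.
  move=> ji; have [F [FE F1]] := affine_functional evenL (B := B) (fun k => (k == j)%:R) 0.
  have bi0 : F (ugen (hb i)) = 0.
    by rewrite FE linE; case: eqP => // ij; move: ji; rewrite /hb_lt ij hb_le_refl.
  have v0 : F (ugen v) = 0.
    rewrite FE; elim: vi => {v vE} [|c' k t ik _ IH]; first by rewrite linear0.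
    rewrite linearP /= IH linE addr0; case: eqP => [kj|_]; last by rewrite mulr0.
    by move: ik; rewrite /hb_lt /= kj (hb_ltW ji).
  have := congr1 F vE; have := congr1 F uE.
  rewrite !linearB !linearD !linearZ /= bi0 F1 !mulr0 !subr0 !addr0 v0 FE.
  by move=> <-.
rewrite uE' big_seq big1 // => j sj.
have := coord0 j (si j sj); rewrite uE' linear_sum /= (bigD1_seq j) //= big1.
  by rewrite linearZ /= linE eqxx mulr1 addr0 => ->; rewrite scale0r.
by move=> k /negPf kj; rewrite linearZ /= linE kj mulr0.
Qed.

End IdentityConsequences.

Section TwistedCommutator.
Variables (K : fieldType) (G : groupType) (eps : altBicharacter K G).
Variables (L : lieColorAlgebra eps) (e : K).
Implicit Types (x y : envalg L) (a : K).

Definition twisted_comm x y := x * y - e *: (y * x).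

Lemma twisted_comm_affinel a k x y :
  twisted_comm (a *: x + k%:A) y = a *: twisted_comm x y + (k * (1 - e)) *: y.
Proof.
rewrite /twisted_comm mulrDl mulrDr -!scalerAl -!scalerAr mul1r mulr1.
rewrite scalerBr scalerDr opprD addrACA; congr (_ + _).
  by rewrite !scalerA mulrC.
by rewrite scalerA -scalerBl mulrBr mulr1 mulrC.
Qed.

Lemma twisted_comm_affiner a k x y :
  twisted_comm x (a *: y + k%:A) = a *: twisted_comm x y + (k * (1 - e)) *: x.
Proof.
rewrite /twisted_comm mulrDl mulrDr -!scalerAl -!scalerAr mul1r mulr1.
rewrite scalerBr scalerDr opprD addrACA; congr (_ + _).
  by rewrite !scalerA mulrC.
by rewrite scalerA -scalerBl mulrBr mulr1 mulrC.
Qed.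

End TwistedCommutator.

(** Otherwise the elements k with eps g k = 1 would form a subgroup containing
    the support, hence g would be in the radical of eps. *)
Lemma proper_basis_deg (K : fieldType) (G : groupType) (eps : altBicharacter K G)
    (L : lieColorAlgebra eps) (properL : proper_grading L) (B : homogBasis L) (g : G) :
  g <> 1%g -> exists j : hbI B, eps g (hbdeg j) != 1.
Proof.
move=> g1; apply: contrapT => no; apply: g1.
have nog j : eps g (hbdeg (h := B) j) = 1.
  by apply: contrapT => /eqP ej; apply: no; exists j.
have [radical gen] := properL.
suff gT : [set k | eps g k = 1]%classic = setT.
  have : [set g | forall k, eps g k = 1]%classic g.
    by move=> k; have : [set: G]%classic k by []; rewrite -gT.
  by rewrite radical.
apply: gen => [|k l /= gk gl|k /= [x kx x0]]; first exact: bichar1r.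
  by rewrite bicharMr gk bicharV bicharVl -bicharV gl invr1 mulr1.
apply: contrapT => gk; move: x0; suff -> : x = 0 by rewrite eqxx.
elim/(homog_ind (B := B)): kx => [//|a y z -> ->|i ik]; first by rewrite scaler0 addr0.
by case: gk; rewrite -ik nog.
Qed.

Theorem theorem2p5 (K : fieldType) (G : groupType)
    (abelG : forall g h : G, (g * h = h * g)%g)
    (eps : altBicharacter K G) (L : lieColorAlgebra eps)
    (evenL : even_lca L) (properL : proper_grading L)
    (sigma : {rmorphism envalg L -> envalg L}) (sigma_bij : bijective sigma)
    (sigma_inner : X_inner sigma) :
  exists h : G,
    (forall (g : G) (x : L), g <> 1%g -> homog L g x ->
       sigma (ugen x) = eps h g *: ugen x) /\
    (forall x : L, homog L 1%g x ->
       exists alpha : K, sigma (ugen x) = ugen x + alpha%:A).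
Proof.
have [B] := homog_basis_exists L.
have dom := envalg_domain evenL B.
have [x [y [x' [x0 y0 x'0 gpi]]]] := X_inner_gpi dom sigma_bij sigma_inner.
have sigmaZ := gpi_scalable evenL x0 y0 gpi B.
have [h hP] := gpi_affine evenL x0 y0 x'0 gpi B.
exists h; split=> [g z g1 gz|z /hP [a ->]]; last first.
  by exists a; rewrite bichar1r scale1r.
elim/(homog_ind (B := B)): gz => {z} [|a z t sz st|i di].
- by rewrite linear0 rmorph0 scaler0.
- by rewrite linearP rmorphD sigmaZ sz st /= scalerDr !scalerA [a * _]mulrC.
have [j eij] := proper_basis_deg properL B g1.
have [a sX] := hP _ _ (hb_homog i); have [c sY] := hP _ _ (hb_homog j).
have [k sZ] := hP _ _ (bracket_homog (hb_homog i) (hb_homog j)).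
have XY := ugen_rel (hb_homog i) (hb_homog j).
have := congr1 sigma XY; rewrite rmorphB sigmaZ !rmorphM /= sX sY sZ -XY.
rewrite -!/(twisted_comm _ _ _) twisted_comm_affinel !twisted_comm_affiner.
(* Compare the coefficients of x_j on both sides. *)
have [F [FE F1]] := affine_functional evenL (B := B) (fun l => (l == j)%:R) 0.
have ij : i == j = false.
  by apply/eqP => ij; move: eij; rewrite -di ij e_diag ?eqxx.
move=> eqT; have := congr1 F eqT.
rewrite /twisted_comm XY !(linearD F, linearZ_LR F) /= F1 !FE !linE ij eqxx bicharMr.
rewrite !mulr0 !addr0 mulr1 mulrA => /eqP; rewrite -subr_eq0 addrAC subrr add0r.
rewrite !mulf_eq0 (negPf (bichar_neq0 _ _ _)) orbF subr_eq0 [1 == _]eq_sym.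
rewrite di (negPf eij) orbF.
by move/eqP ->; rewrite scale0r addr0.
Qed.
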